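(* Let $b$ be a braid on $n$ strands with associated permutation $w$, and let $\mathcal{Y}(b)=T_b[y_1,\dots,y_n]$ be its $y$-ified Rouquier complex with (curved) differential $d_y=d+\sum_{i=1}^n\xi_iy_i$. For $1\le k\le n$ there exist operators $$F_k:=\sum_{i=1}^nh_{k-1}\left(x_i,x'_{w^{-1}(i)}\right)\frac{\partial}{\partial y_i}+u_k$$ of $(A,Q,T)$-degree $(0,2k,2)$ on $\mathcal{Y}(b)$ such that for all $k,m,i$ $$[d_y,F_k]=0,\quad[F_k,F_m]=0,\quad[F_k,x_i]=0,\quad[F_k,y_i]=h_{k-1}\left(x_i,x'_{w^{-1}(i)}\right).$$
   Context: The $(A,Q,T)$-degree consists of Hochschild, quantum and homological degree. $R=\mathbb{C}[x_1,\dots,x_n]$, $B=R\otimes_{R^{S_n}}R$ with generators $x_i=x_i\otimes1$, $x_i'=1\otimes x_i$ of quantum degree $2$. Differentials have degree $-1$; signs follow homological degree. $h_m$ is the complete homogeneous symmetric polynomial ($h_0=1$, $h_m=0$ for $m<0$). For $w\in S_n$, $\mathcal{A}_w$ is the free graded-commutative dg $B$-algebra on $\xi_1,\dots,\xi_n$ (homological degree $1$, quantum degree $2$), $u_1,\dots,u_n$ (homological degree $2$, $u_k$ of quantum degree $2k$) with $d\xi_i=x_i-x'_{w^{-1}(i)}$, $du_k=\sum_ih_{k-1}(x_i,x'_{w^{-1}(i)})\xi_i$. Twisted coproducts $\mathcal{A}_{vw}\to\mathcal{A}_v\otimes_R\mathcal{A}_w$: $x_i\mapsto x_i\otimes1$,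 $x_i'\mapsto1\otimes x_i'$, $\xi_i\mapsto\xi_i\otimes1+1\otimes\xi_{v^{-1}(i)}$, $u_k\mapsto u_k\otimes1+1\otimes u_k+\sum_ih_{k-2}(x_i,x'_{v^{-1}(i)},x''_{w^{-1}v^{-1}(i)})\xi_i\otimes\xi_{v^{-1}(i)}$, with $x_i=x_i\otimes1$, $x'_i=x_i'\otimes1=1\otimes x_i$, $x_i''=1\otimes x_i'$. $s_i=(i,i+1)$, $B_i=R\otimes_{R^{s_i}}R$, $b_i:B_i\to R$, $1\mapsto1$, $b_i^*:R\to B_i(2)$, $1\mapsto x_i-x'_{i+1}$ (where $M(m)_j=M_{j+m}$); $T_i=[B_i(1)\xrightarrow{b_i}R(1)]$, $T_i^{-1}=[R(-1)\xrightarrow{b_i^*}B_i(1)]$, $B_i(1)$ in homological degree $0$. $\mathcal{A}_{s_i}$ acts on $T_i$ (resp. $T_i^{-1}$) with $\xi_i$ acting as $b_i^*:R\to B_i$ (resp. $b_i:B_i\to R$), $\xi_{i+1}=-\xi_i$, other $\xi_j=0$, all $u_k=0$. For $b=\sigma_{i_1}^{\varepsilon_1}\cdots\sigma_{i_r}^{\varepsilon_r}$, $T_b=T_{i_1}^{\varepsilon_1}\otimes_R\cdots\otimes_RT_{i_r}^{\varepsilon_r}$ is an $\mathcal{A}_w$-module, $w=s_{i_1}\cdots s_{i_r}$, via iterated twisted coproducts; $\xi_i$ and $u_k$ in the claim denote this action, extended $\mathbb{C}[y_1,\dots,y_n]$-linearly. $\mathcal{Y}(b)=T_b\otimes\mathbb{C}[y_1,\dots,y_n]$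 with $y_i$ of $(A,Q,T)$-degree $(0,-2,-2)$; $d_y^2=\sum_i(x_i-x'_{w^{-1}(i)})y_i$. Brackets are supercommutators. *)

(* Defs.v *)
From HB Require Import structures.
From mathcomp Require Import all_boot all_order all_fingroup all_algebra.
From mathcomp Require Import ring_quotient generic_quotient.
From mathcomp Require Import freeg mpoly.
From mathcomp Require Import boolp reals complex.
From mathcomp Require Import zify ring.

Set Implicit Arguments.
Unset Strict Implicit.
Unset Printing Implicit Defensive.

Import GRing.Theory Num.Theory.
Local Open Scope ring_scope.

(* Degrees are triples (A, Q, T) = (Hochschild, quantum, homological).        *)
Notation degree := (int * int * int)%type.

Section Tensor.
Variables (S : Type) (M N : zmodType) (rho : S -> M -> M) (lam : S -> N -> N).

Local Notation V := {freeg (M * N)%type / int}.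
Local Notation gen m n := (<< 1 *g (m, n) >> : V).

Inductive tensor_rel : V -> Prop :=
| tensor_rel0 : tensor_rel 0
| tensor_relB D E : tensor_rel D -> tensor_rel E -> tensor_rel (D - E)
| tensor_relDl m m' n : tensor_rel (gen (m + m') n - (gen m n + gen m' n))
| tensor_relDr m n n' : tensor_rel (gen m (n + n') - (gen m n + gen m n'))
| tensor_relA s m n : tensor_rel (gen (rho s m) n - gen m (lam s n)).

Definition tensor_ker : {pred V} := fun D => `[< tensor_rel D >].

Lemma tensor_ker_zmod : zmod_closed tensor_ker.
Proof.
split; first exact/asboolP/tensor_rel0.
by move=> D E /asboolP hD /asboolP hE; apply/asboolP/tensor_relB.
Qed.

HB.instance Definition _ := GRing.isZmodClosed.Build V tensor_ker tensor_ker_zmod.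

(* M (x)_S N, where s in S acts by rho s on M and by lam s on N.              *)
Definition tensor : Type := Quotient.quot tensor_ker.
HB.instance Definition _ := GRing.Zmodule.on tensor.

Definition tens (m : M) (n : N) : tensor := \pi_(Quotient.quot tensor_ker)%qT (gen m n).

(* The homomorphism m (x) n |-> phi m n; meaningful when phi is biadditive    *)
(* and balanced, see [tliftE] and [tliftD].                                   *)
Definition tlift (A : zmodType) (phi : M -> N -> A) (t : tensor) : A :=
  fglift (fun p => phi p.1 p.2 : zmodule A)
    (repr (t : Quotient.quot tensor_ker)).

(* Homogeneous elements of the tensor product of two graded groups.           *)
Inductive thom (homM : degree -> M -> Prop) (homN : degree -> N -> Prop)
    (e : degree) : tensor -> Prop :=
| thom0 : thom homM homN e 0
| thomD x y : thom homM homN e x -> thom homM homN e y ->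
    thom homM homN e (x + y)
| thom_tens e1 e2 m n : homM e1 m -> homN e2 n -> e1 + e2 = e ->
    thom homM homN e (tens m n).

Lemma tensor_eq (D E : V) : tensor_rel (D - E) ->
  \pi_(Quotient.quot tensor_ker)%qT D = \pi_(Quotient.quot tensor_ker)%qT E.
Proof. by move=> h; apply/eqP; rewrite -Quotient.idealrBE; apply/asboolP. Qed.

Lemma tensDl m m' n : tens (m + m') n = tens m n + tens m' n.
Proof. by rewrite /tens -raddfD; apply/tensor_eq/tensor_relDl. Qed.

Lemma tensDr m n n' : tens m (n + n') = tens m n + tens m n'.
Proof. by rewrite /tens -raddfD; apply/tensor_eq/tensor_relDr. Qed.

Lemma tensA s m n : tens (rho s m) n = tens m (lam s n).
Proof. exact/tensor_eq/tensor_relA. Qed.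

Lemma tens0l n : tens 0 n = 0.
Proof. by apply: (addrI (tens 0 n)); rewrite -tensDl !addr0. Qed.

Lemma tens0r m : tens m 0 = 0.
Proof. by apply: (addrI (tens m 0)); rewrite -tensDr !addr0. Qed.

Lemma tensNl m n : tens (- m) n = - tens m n.
Proof. by apply: (addrI (tens m n)); rewrite -tensDl !subrr tens0l. Qed.

Lemma tensNr m n : tens m (- n) = - tens m n.
Proof. by apply: (addrI (tens m n)); rewrite -tensDr !subrr tens0r. Qed.

Lemma tensor_ind (P : tensor -> Prop) :
  (forall x y, P x -> P y -> P (x + y)) -> (forall m n, P (tens m n)) ->
  forall t, P t.
Proof.
move=> PD Pt; have P0 : P 0 by rewrite -(tens0l 0).
move=> t; rewrite -[t](@reprK _ (Quotient.quot tensor_ker)).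
set D : V := repr _; rewrite -[D]freeg_sumE raddf_sum.
elim: (dom D) => [|[m n] r IH]; first by rewrite big_nil.
rewrite big_cons; apply: (PD) IH; set c := coeff _ _.
have nat_case k : P (\pi_(Quotient.quot tensor_ker)%qT << k%:Z *g (m, n) >>).
  elim: k => [|k IHk]; first by rewrite freegU0 raddf0.
  by rewrite -addn1 PoszD -freegUD raddfD; apply: (PD) => [|]; [exact: IHk | exact: Pt].
case: c => k; first exact: nat_case.
rewrite NegzE -freegUN raddfN; elim: k.+1 => [|j IHj].
  by rewrite freegU0 raddf0 oppr0.
rewrite -addn1 PoszD -freegUD raddfD opprD; apply: (PD) => [|]; first exact: IHj.
by rewrite -/(tens m n) -tensNl.
Qed.

Section Lift.
Variables (A : zmodType) (phi : M -> N -> A).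
Hypothesis phiDl : forall m m' n, phi (m + m') n = phi m n + phi m' n.
Hypothesis phiDr : forall m n n', phi m (n + n') = phi m n + phi m n'.
Hypothesis phiA : forall s m n, phi (rho s m) n = phi m (lam s n).

Let lift (D : V) : zmodule A := fglift (fun p => phi p.1 p.2 : zmodule A) D.

Let liftB : {morph lift : x y / x - y}.
Proof. exact: lift_is_additive. Qed.

Let lift0 : lift 0 = 0.
Proof. by rewrite -(subrr 0) liftB subrr. Qed.

Let liftD : {morph lift : x y / x + y}.
Proof.
by move=> x y; rewrite -[y in LHS]opprK liftB -[- y]add0r liftB lift0 sub0r opprK.
Qed.

Let liftU m n : lift (gen m n) = phi m n.
Proof. by rewrite /lift liftU scale1r. Qed.

Let lift_rel D : tensor_rel D -> lift D = 0.
Proof.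
elim=> [|x y _ hx _ hy|m m' n|m n n'|s m n] //.
- by rewrite liftB hx hy subrr.
- by rewrite liftB liftD !liftU phiDl subrr.
- by rewrite liftB liftD !liftU phiDr subrr.
- by rewrite liftB !liftU phiA subrr.
Qed.

Let tlift_pi (D : V) :
  tlift phi (\pi_(Quotient.quot tensor_ker)%qT D) = lift D.
Proof.
apply/eqP; rewrite -subr_eq0 -[X in X - _]/(lift _) -liftB; apply/eqP/lift_rel.
by apply/asboolP; rewrite -[`[< _ >]]/(_ \in tensor_ker) Quotient.idealrBE reprK.
Qed.

Lemma tliftE m n : tlift phi (tens m n) = phi m n.
Proof. by rewrite tlift_pi liftU. Qed.

Lemma tliftD : {morph tlift phi : x y / x + y}.
Proof.
move=> x y; rewrite -[x](@reprK _ (Quotient.quot tensor_ker)).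
rewrite -[y](@reprK _ (Quotient.quot tensor_ker)).
by rewrite -[LHS](congr1 (tlift phi) (raddfD _ _ _)) !tlift_pi liftD.
Qed.

End Lift.
End Tensor.

Section TensorMap.
Variables (S : Type) (M N M' N' : zmodType).
Variables (rho : S -> M -> M) (lam : S -> N -> N).
Variables (rho' : S -> M' -> M') (lam' : S -> N' -> N').

(* The homomorphism f (x) g, without sign.                                    *)
Definition tmap (f : M -> M') (g : N -> N') :
    tensor rho lam -> tensor rho' lam' :=
  tlift (fun m n => tens rho' lam' (f m) (g n)).

Variables (f : M -> M') (g : N -> N').
Hypothesis fD : {morph f : x y / x + y}.
Hypothesis gD : {morph g : x y / x + y}.
Hypothesis fA : forall s m, f (rho s m) = rho' s (f m).
Hypothesis gA : forall s n, g (lam s n) = lam' s (g n).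

Lemma tmapE m n : tmap f g (tens rho lam m n) = tens rho' lam' (f m) (g n).
Proof.
rewrite /tmap tliftE // => *; rewrite ?fD ?gD ?tensDl ?tensDr //.
by rewrite fA gA tensA.
Qed.

Lemma tmapD : {morph tmap f g : x y / x + y}.
Proof.
apply: tliftD => *; rewrite ?fD ?gD ?tensDl ?tensDr //.
by rewrite fA gA tensA.
Qed.

End TensorMap.

Arguments tmap {S M N M' N' rho lam rho' lam'} f g t.

(* h_m(f_1, .., f_s) v for commuting operators f_1, .., f_s: the sum of       *)
(* f_1^a_1 .. f_s^a_s v over all a_1 + .. + a_s = m.                          *)
Fixpoint hsym_nat (V : zmodType) (m : nat) (fs : seq (V -> V)) (v : V) : V :=
  if fs is f :: fs' then \sum_(a < m.+1) iter a f (hsym_nat (m - a) fs' v)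
  else if m == 0%N then v else 0.

Definition hsym (V : zmodType) (m : int) (fs : seq (V -> V)) (v : V) : V :=
  if m is Posz m' then hsym_nat m' fs v else 0.

Definition koszul (V : zmodType) (t : int) (v : V) : V :=
  if odd `|t|%N then - v else v.

(* [f, g] for operators f, g of homological degrees p, q.                     *)
Definition scomm (V : zmodType) (p q : int) (f g : V -> V) (v : V) : V :=
  f (g v) - koszul (p * q) (g (f v)).

Definition homog_op (V : zmodType) (hom : degree -> V -> Prop) (delta : degree)
    (f : V -> V) : Prop :=
  forall e v, hom e v -> hom (e + delta) (f v).

(* Grading of a polynomial ring whose variables have degree delta.            *)
Definition poly_hom (n : nat) (K : comNzRingType) (delta e : degree)
    (p : {mpoly K[n]}) : Prop :=
  p = 0 \/ exists2 d : nat, e = delta *+ d & p \is d.-homog.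

Record is_action (A : nzRingType) (V : zmodType) (a : A -> V -> V) : Prop := {
  act1 : forall v, a 1 v = v;
  actM : forall r s v, a (r * s) v = a r (a s v);
  actDl : forall r s v, a (r + s) v = a r v + a s v;
  actD : forall r, {morph a r : v w / v + w}
}.

Section AModules.
Variables (K : fieldType) (n : nat).
Local Notation R := {mpoly K[n]}.

Definition bilinear_op (V V' : zmodType) (l r : R -> V -> V)
    (l' r' : R -> V' -> V') (f : V -> V') : Prop :=
  [/\ {morph f : v w / v + w},
      forall p v, f (l p v) = l' p (f v)
    & forall p v, f (r p v) = r' p (f v)].

(* Underlying data of a dg A_w-module: a graded module over                   *)
(* B = R (x)_(R^S_n) R, that is an R-bimodule on which symmetric polynomials  *)
(* act equally on both sides, with its differential and the actions of the    *)
(* generators xi_i and u_k (k = 1, .., n) of A_w over B. [sgn] is             *)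
(* v |-> (-1)^t v on elements v of homological degree t.                      *)
Record amodule := AModule {
  car :> zmodType;
  lact : R -> car -> car;
  ract : R -> car -> car;
  hom : degree -> car -> Prop;
  sgn : car -> car;
  dif : car -> car;
  xi : 'I_n -> car -> car;
  u : nat -> car -> car;
  lactP : is_action lact;
  ractP : is_action ract;
  lractC : forall p q v, lact p (ract q v) = ract q (lact p v);
  lract_sym : forall p v, p \is symmetric -> lact p v = ract p v;
  sgn_bilinear : bilinear_op lact ract lact ract sgn;
  sgn_hom : forall e v, hom e v -> sgn v = koszul e.2 v;
  dif_bilinear : bilinear_op lact ract lact ract dif;
  xi_bilinear : forall i, bilinear_op lact ract lact ract (xi i);
  u_bilinear : forall k, bilinear_op lact ract lact ract (u k)
}.

Lemma mulr_is_action : is_action (fun p q : R => p * q).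
Proof. by split=> [v|r s v|r s v|r v w]; rewrite ?mul1r ?mulrA ?mulrDl ?mulrDr. Qed.

Lemma bilinear_comp (V V' V'' : zmodType) (l r : R -> V -> V)
  (l' r' : R -> V' -> V') (l'' r'' : R -> V'' -> V'') f g :
  bilinear_op l' r' l'' r'' f -> bilinear_op l r l' r' g ->
  bilinear_op l r l'' r'' (f \o g).
Proof.
move=> [fD fl fr] [gD gl gr]; split=> [v w|p v|p v] /=.
- by rewrite gD fD.
- by rewrite gl fl.
- by rewrite gr fr.
Qed.

Section Bilinear.
Variables (V : zmodType) (l r : R -> V -> V).
Hypotheses (lP : is_action l) (rP : is_action r).
Hypothesis lrC : forall p q v, l p (r q v) = r q (l p v).
Local Notation bil := (bilinear_op l r l r).

Let a0 (a : R -> V -> V) p : is_action a -> a p 0 = 0 :> V.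
Proof. by move=> aP; apply: (addrI (a p 0)); rewrite -(actD aP) !addr0. Qed.

Let aN (a : R -> V -> V) p v : is_action a -> a p (- v) = - a p v :> V.
Proof.
move=> aP; apply: (addrI (a p v)).
by rewrite -(actD aP) !subrr a0.
Qed.

Lemma bilinear_id : bil id. Proof. by []. Qed.

Lemma bilinear0 : bil (fun=> 0).
Proof. by split=> [x y|p v|p v]; rewrite ?addr0 ?(a0 _ lP) ?(a0 _ rP). Qed.

Lemma bilinearN f : bil f -> bil (fun v => - f v).
Proof.
by move=> [fD fl fr]; split=> [v w|p v|p v];
   rewrite ?fD ?fl ?fr ?opprD ?(aN _ _ lP) ?(aN _ _ rP).
Qed.

Lemma bilinearD f g : bil f -> bil g -> bil (fun v => f v + g v).
Proof.
move=> [fD fl fr] [gD gl gr]; split=> [v w|p v|p v].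
- by rewrite fD gD addrACA.
- by rewrite fl gl (actD lP).
- by rewrite fr gr (actD rP).
Qed.

Lemma bilinear_sum (I : Type) (s : seq I) (F : I -> V -> V) :
  (forall i, bil (F i)) -> bil (fun v => \sum_(i <- s) F i v).
Proof.
move=> FP; elim: s => [|i s [sD sl sr]].
  by split=> [x y|p v|p v]; rewrite !big_nil ?addr0 ?(a0 _ lP) ?(a0 _ rP).
have [fD fl fr] := FP i; split=> [v w|p v|p v].
- by rewrite !big_cons fD sD addrACA.
- by rewrite !big_cons fl sl (actD lP).
- by rewrite !big_cons fr sr (actD rP).
Qed.

Lemma bilinear_iter f a : bil f -> bil (iter a f).
Proof. by move=> fP; elim: a => [|a IH] //; apply: bilinear_comp fP IH. Qed.

Lemma bilinear_hsym m fs :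
  (forall f, List.In f fs -> bil f) -> bil (hsym m fs).
Proof.
case: m => m; last by move=> _; apply: bilinear0.
rewrite /hsym; elim: fs m => [|f fs IH] m fsP /=.
  by case: eqP => _; [apply: bilinear_id | apply: bilinear0].
apply: bilinear_sum => a; apply: bilinear_comp.
  by apply/bilinear_iter/fsP; left.
by apply: IH => g gfs; apply: fsP; right.
Qed.

Lemma bilinear_lact p : bil (l p).
Proof.
split=> [v w|q v|q v]; first exact: (actD lP).
  by rewrite -!(actM lP) mulrC.
exact: lrC.
Qed.

Lemma bilinear_ract p : bil (r p).
Proof.
split=> [v w|q v|q v]; first exact: (actD rP).
  by rewrite lrC.
by rewrite -!(actM rP) mulrC.
Qed.

End Bilinear.

Section BimoduleTensor.
Variables (S : Type) (M N : zmodType) (rho : S -> M -> M) (lam : S -> N -> N).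
Variables (l : R -> M -> M) (r : R -> N -> N).
Hypotheses (lP : is_action l) (rP : is_action r).
Hypothesis rhoD : forall s, {morph rho s : x y / x + y}.
Hypothesis lamD : forall s, {morph lam s : x y / x + y}.
Hypothesis rhol : forall s p m, l p (rho s m) = rho s (l p m).
Hypothesis lamr : forall s p m, r p (lam s m) = lam s (r p m).

Definition tlact (p : R) : tensor rho lam -> tensor rho lam := tmap (l p) id.
Definition tract (p : R) : tensor rho lam -> tensor rho lam := tmap id (r p).

Lemma tlactD p : {morph tlact p : x y / x + y}.
Proof. by apply: tmapD => //; apply: (actD lP). Qed.

Lemma tractD p : {morph tract p : x y / x + y}.
Proof. by apply: tmapD => //; apply: (actD rP). Qed.

Lemma tlactE p m k : tlact p (tens rho lam m k) = tens rho lam (l p m) k.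
Proof. by apply: tmapE => //; apply: (actD lP). Qed.

Lemma tractE p m k : tract p (tens rho lam m k) = tens rho lam m (r p k).
Proof. by apply: tmapE => //; apply: (actD rP). Qed.

Lemma tlactP : is_action tlact.
Proof.
split; last exact: tlactD.
- by elim/tensor_ind => [x y hx hy|m k]; rewrite ?tlactD ?hx ?hy // tlactE (act1 lP).
- move=> p q; elim/tensor_ind => [x y hx hy|m k]; rewrite ?tlactD ?hx ?hy //.
  by rewrite !tlactE (actM lP).
- move=> p q; elim/tensor_ind => [x y hx hy|m k].
    by rewrite !tlactD hx hy addrACA.
  by rewrite !tlactE (actDl lP) tensDl.
Qed.

Lemma tractP : is_action tract.
Proof.
split; last exact: tractD.
- by elim/tensor_ind => [x y hx hy|m k]; rewrite ?tractD ?hx ?hy // tractE (act1 rP).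
- move=> p q; elim/tensor_ind => [x y hx hy|m k]; rewrite ?tractD ?hx ?hy //.
  by rewrite !tractE (actM rP).
- move=> p q; elim/tensor_ind => [x y hx hy|m k].
    by rewrite !tractD hx hy addrACA.
  by rewrite !tractE (actDl rP) tensDr.
Qed.

Lemma tlractC p q t : tlact p (tract q t) = tract q (tlact p t).
Proof.
elim/tensor_ind: t => [x y hx hy|m k]; last by rewrite tlactE tractE tlactE tractE.
by rewrite !(tractD, tlactD) hx hy.
Qed.

End BimoduleTensor.

Section ATensor.
Variables M N : amodule.
Local Notation T := (tensor (@ract M) (@lact N)).
Local Notation "f ** g" :=
  (tmap f g : T -> T) (at level 40, no associativity).

Definition atl : R -> T -> T := tlact (@lact M).
Definition atm (p : R) : T -> T := @ract M p ** id.
Definition atr : R -> T -> T := tract (@ract N).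
Local Notation bilT := (bilinear_op atl atr atl atr).

Lemma tl_action : is_action atl.
Proof.
by apply: tlactP => *; rewrite ?(actD (lactP _)) ?lractC //; apply: lactP.
Qed.

Lemma tr_action : is_action atr.
Proof.
by apply: tractP => *; rewrite ?(actD (ractP _)) ?lractC //; apply: ractP.
Qed.

Lemma atlE p m k : atl p (tens (@ract M) (@lact N) m k) = tens _ _ (lact p m) k.
Proof. by apply: tlactE => *; rewrite ?lractC //; apply: lactP. Qed.

Lemma atrE p m k : atr p (tens (@ract M) (@lact N) m k) = tens _ _ m (ract p k).
Proof. by apply: tractE => *; rewrite ?lractC //; apply: ractP. Qed.

Lemma atlD p : {morph atl p : x y / x + y}. Proof. exact: actD tl_action p. Qed.
Lemma atrD p : {morph atr p : x y / x + y}. Proof. exact: actD tr_action p. Qed.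

Lemma atlrC p q t : atl p (atr q t) = atr q (atl p t).
Proof. by apply: tlractC => *; rewrite ?lractC //; (apply: lactP || apply: ractP). Qed.

Lemma at_sym p t : p \is symmetric -> atl p t = atr p t.
Proof.
move=> sp; elim/tensor_ind: t => [x y hx hy|m k]; first by rewrite atlD atrD hx hy.
by rewrite atlE atrE (lract_sym _ sp) tensA (lract_sym _ sp).
Qed.

Lemma tmap_bil f g : bilinear_op (@lact M) (@ract M) (@lact M) (@ract M) f ->
  bilinear_op (@lact N) (@ract N) (@lact N) (@ract N) g -> bilT (f ** g).
Proof.
move=> [fD fl fr] [gD gl gr].
have tD : {morph f ** g : x y / x + y} by apply: tmapD.
have tE m k : (f ** g) (tens _ _ m k) = tens _ _ (f m) (g k) by apply: tmapE.
split=> // p; elim/tensor_ind => [x y hx hy|m k].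
- by rewrite atlD !tD hx hy atlD.
- by rewrite atlE !tE atlE fl.
- by rewrite atrD !tD hx hy atrD.
- by rewrite atrE !tE atrE gr.
Qed.

Variables v w : 'S_n.

Definition tsgn : T -> T := @sgn M ** @sgn N.

#[local] Hint Resolve tl_action tr_action atlrC : core.

Definition tdif (t : T) : T := (@dif M ** id) t + (@sgn M ** @dif N) t.

Definition txi (i : 'I_n) (t : T) : T :=
  (@xi M i ** id) t + (@sgn M ** @xi N ((v^-1)%g i)) t.

(* The Koszul rule makes xi_i (x) xi_j the map m (x) n |->                    *)
(* (-1)^|m| xi_i m (x) xi_j n.                                                *)
Definition tu (k : nat) (t : T) : T :=
  (@u M k ** id) t + (id ** @u N k) t +
  \sum_(i < n) hsym (k%:Z - 2)
     [:: atl 'X_i; atm 'X_((v^-1)%g i); atr 'X_((w^-1)%g ((v^-1)%g i))]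
     (((@xi M i \o @sgn M) ** @xi N ((v^-1)%g i)) t).

Lemma tsgn_hom e t : thom (@hom M) (@hom N) e t -> tsgn t = koszul e.2 t.
Proof.
have [sD _ _] : bilT tsgn by apply: tmap_bil; apply: sgn_bilinear.
have kD s (x y : T) : koszul s (x + y) = koszul s x + koszul s y.
  by rewrite /koszul; case: ifP => // _; rewrite opprD.
elim=> [|x y _ hx _ hy|e1 e2 m k hm hk <-].
- apply: (addrI (tsgn 0)); rewrite -sD addr0 /koszul oppr0 if_same addr0 //.
- by rewrite sD hx hy kD.
have [mD _ mr] := sgn_bilinear M; have [kD' kl _] := sgn_bilinear N.
rewrite /tsgn tmapE // (sgn_hom hm) (sgn_hom hk) /koszul /=.
have -> : odd `|(e1.2 + e2.2)%R|%N = odd `|e1.2|%N (+) odd `|e2.2|%N by lia.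
by do 2!case: odd; rewrite ?tensNl ?tensNr ?opprK.
Qed.

Lemma tdif_bil : bilT tdif.
Proof.
apply: bilinearD => //; apply: tmap_bil => //;
  (apply: dif_bilinear || apply: sgn_bilinear).
Qed.

Lemma txi_bil i : bilT (txi i).
Proof.
apply: bilinearD => //; apply: tmap_bil => //;
  (apply: xi_bilinear || apply: sgn_bilinear).
Qed.

Lemma atm_bil p : bilT (atm p).
Proof. by apply: tmap_bil => //; apply: bilinear_ract; apply: ractP || apply: lractC. Qed.

Lemma tu_bil k : bilT (tu k).
Proof.
apply: bilinearD => //.
  by apply: bilinearD => //; apply: tmap_bil => //; apply: u_bilinear.
apply: bilinear_sum => // i; apply: bilinear_comp.
  apply: bilinear_hsym => // f /= [<-|[<-|[<-|//]]]; last exact: bilinear_ract.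
    exact: bilinear_lact.
  exact: atm_bil.
apply: tmap_bil; last exact: xi_bilinear.
by apply: bilinear_comp; [apply: xi_bilinear | apply: sgn_bilinear].
Qed.

(* M (x)_R N for an A_v-module M and an A_w-module N, as an A_vw-module via   *)
(* the twisted coproduct.                                                     *)
Definition atensor : amodule :=
  @AModule T atl atr (thom (@hom M) (@hom N)) tsgn tdif txi tu
    tl_action tr_action atlrC at_sym
    (tmap_bil (sgn_bilinear M) (sgn_bilinear N)) tsgn_hom tdif_bil
    txi_bil tu_bil.

End ATensor.

Definition R_hom : degree -> R -> Prop := poly_hom (0, 2, 0).

Lemma R_hom_T e p : R_hom e p -> p = 0 \/ e.2 = 0.
Proof.
case=> [->|[d -> _]]; [by left | right].
elim: d => // d IH; rewrite mulrS.
by transitivity (0 + (((0, 2, 0) : degree) *+ d).2); last by rewrite IH.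
Qed.
Lemma Rsym (p v : R) : p \is symmetric -> p * v = p * v. Proof. by []. Qed.
Lemma Rsgn e (v : R) : R_hom e v -> v = koszul e.2 v.
Proof.
by case/R_hom_T=> ->; rewrite /koszul //= oppr0 if_same.
Qed.
Lemma Rbil0 : bilinear_op (fun p q : R => p * q) (fun p q : R => p * q)
  (fun p q : R => p * q) (fun p q : R => p * q) (fun=> 0).
Proof. exact: bilinear0 mulr_is_action mulr_is_action. Qed.

(* The complex of the braid without crossings.                                *)
Definition T1 : amodule :=
  @AModule R (fun p q => p * q) (fun p q => p * q) R_hom id (fun=> 0)
    (fun _ _ => 0) (fun _ _ => 0) mulr_is_action mulr_is_action
    (fun p q v => mulrCA p q v) Rsym (bilinear_id _ _) Rsgn Rbil0
    (fun=> Rbil0) (fun=> Rbil0).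

Section Crossing.
(* Strands are numbered from 0, so that i : nat stands for the generator      *)
(* exchanging the strands i + 1 and i + 2.                                    *)
Variables (i : nat) (lti : (i.+1 < n)%N).

Definition strand : 'I_n := Ordinal (ltnW lti).
Definition strandS : 'I_n := Ordinal lti.
Definition s_ : 'S_n := tperm strand strandS.

Definition invariants : Type := {f : R | msym s_ f == f}.

(* B_i = R (x)_(R^s_i) R                                                      *)
Definition Bs : zmodType :=
  tensor (fun (s : invariants) (p : R) => p * val s)
         (fun (s : invariants) (p : R) => val s * p).
Definition Bpure (p q : R) : Bs :=
  tens (fun (s : invariants) (p : R) => p * val s)
       (fun (s : invariants) (p : R) => val s * p) p q.
Definition Bhom (e : degree) (x : Bs) : Prop := thom R_hom R_hom e x.
Definition Bl (p : R) : Bs -> Bs := tlact (fun p q => p * q) p.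
Definition Br (p : R) : Bs -> Bs := tract (fun p q => p * q) p.

(* b_i, the bimodule map with 1 (x) 1 |-> 1                                   *)
Definition b_ : Bs -> R := tlift (fun p q : R => p * q).

(* b_i^*, the bimodule map with 1 |-> x_i (x) 1 - 1 (x) x_(i+1)               *)
Definition bstar (p : R) : Bs := Bpure (p * 'X_strand) 1 - Bpure p 'X_strandS.

Lemma Bl_action : is_action Bl.
Proof.
apply: tlactP; first exact: mulr_is_action.
by move=> s p m; rewrite mulrA.
Qed.

Lemma Br_action : is_action Br.
Proof.
apply: tractP; first exact: mulr_is_action.
by move=> s p m; rewrite mulrCA.
Qed.

Lemma BlE p a c : Bl p (Bpure a c) = Bpure (p * a) c.
Proof.
apply: tlactE; first exact: mulr_is_action.
by move=> s q m; rewrite mulrA.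
Qed.

Lemma BrE p a c : Br p (Bpure a c) = Bpure a (p * c).
Proof.
apply: tractE; first exact: mulr_is_action.
by move=> s q m; rewrite mulrCA.
Qed.

Lemma BlD p : {morph Bl p : x y / x + y}. Proof. exact: actD Bl_action p. Qed.
Lemma BrD p : {morph Br p : x y / x + y}. Proof. exact: actD Br_action p. Qed.

Lemma BlN p x : Bl p (- x) = - Bl p x.
Proof.
have Bl0 : Bl p 0 = 0 by apply: (addrI (Bl p 0)); rewrite -BlD !addr0.
by apply: (addrI (Bl p x)); rewrite -BlD !subrr.
Qed.

Lemma BrN p x : Br p (- x) = - Br p x.
Proof.
have Br0 : Br p 0 = 0 by apply: (addrI (Br p 0)); rewrite -BrD !addr0.
by apply: (addrI (Br p x)); rewrite -BrD !subrr.
Qed.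

Lemma BlrC p q x : Bl p (Br q x) = Br q (Bl p x).
Proof.
elim/tensor_ind: x => [x y hx hy|m k]; first by rewrite !(BlD, BrD) hx hy.
by rewrite -[tens _ _ m k]/(Bpure m k) BrE !BlE BrE.
Qed.

Lemma Bpure_inv f p q : msym s_ f == f -> Bpure (p * f) q = Bpure p (f * q).
Proof. by move=> hf; apply: (tensA _ _ (exist _ f hf)). Qed.

Lemma B_sym p x : p \is symmetric -> Bl p x = Br p x.
Proof.
move=> /issymP sp; elim/tensor_ind: x => [x y hx hy|m k].
  by rewrite BlD BrD hx hy.
by rewrite -[tens _ _ m k]/(Bpure m k) BlE BrE mulrC Bpure_inv // sp.
Qed.

Lemma b_D : {morph b_ : x y / x + y}.
Proof.
by apply: tliftD => *; rewrite ?mulrDl ?mulrDr ?mulrA.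
Qed.

Lemma b_E p q : b_ (Bpure p q) = p * q.
Proof. by apply: tliftE => *; rewrite ?mulrDl ?mulrDr ?mulrA. Qed.

Lemma b_bil : bilinear_op Bl Br (fun p q : R => p * q) (fun p q : R => p * q) b_.
Proof.
split; first exact: b_D.
- move=> p; elim/tensor_ind => [x y hx hy|m k].
    by rewrite BlD !b_D hx hy mulrDr.
  by rewrite -[tens _ _ m k]/(Bpure m k) BlE !b_E mulrA.
- move=> p; elim/tensor_ind => [x y hx hy|m k].
    by rewrite BrD !b_D hx hy mulrDr.
  by rewrite -[tens _ _ m k]/(Bpure m k) BrE !b_E mulrCA.
Qed.

Lemma BpureDl p p' q : Bpure (p + p') q = Bpure p q + Bpure p' q.
Proof. exact: tensDl. Qed.
Lemma BpureDr p q q' : Bpure p (q + q') = Bpure p q + Bpure p q'.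
Proof. exact: tensDr. Qed.
Lemma BpureNl p q : Bpure (- p) q = - Bpure p q.
Proof. exact: tensNl. Qed.

Lemma bstarD : {morph bstar : x y / x + y}.
Proof.
by move=> x y; rewrite /bstar mulrDl !BpureDl opprD addrACA.
Qed.

Lemma bstarl p q : bstar (p * q) = Bl p (bstar q).
Proof. by rewrite /bstar BlD BlN !BlE mulrA. Qed.

Lemma strandSN : strandS != strand.
Proof. by apply/eqP => /(congr1 val) /= /eqP; rewrite eqn_leq ltnn. Qed.

Lemma msym_X (j : 'I_n) : msym s_ ('X_j : R) = 'X_(s_ j).
Proof.
rewrite msymX; congr mpolyX; apply/mnmP => k.
by rewrite mnmE !mnm1E eq_sym (canF_eq (permKV _)) eq_sym.
Qed.

Lemma sym_add : msym s_ ('X_strand + 'X_strandS : R) == 'X_strand + 'X_strandS.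
Proof. by rewrite msymD !msym_X tpermL tpermR addrC. Qed.

Lemma sym_mul : msym s_ ('X_strand * 'X_strandS : R) == 'X_strand * 'X_strandS.
Proof. by rewrite msymM !msym_X tpermL tpermR mulrC. Qed.

Lemma sym_C c : msym s_ (c%:MP : R) == c%:MP.
Proof. by rewrite -[c%:MP]mulr1 mul_mpolyC msymZ msym1. Qed.

Definition intertw (p : R) := forall q, bstar (p * q) = Br p (bstar q).

Lemma intertw_inv p : msym s_ p == p -> intertw p.
Proof.
move=> sp q; rewrite /bstar BrD BrN !BrE -!(Bpure_inv _ _ sp).
by rewrite [p * q]mulrC mulrAC.
Qed.

Lemma intertwM p q : intertw p -> intertw q -> intertw (p * q).
Proof.
move=> hp hq r; rewrite -mulrA hp hq.
by rewrite -(actM Br_action).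
Qed.

Lemma intertwD p q : intertw p -> intertw q -> intertw (p + q).
Proof. by move=> hp hq r; rewrite mulrDl bstarD hp hq (actDl Br_action). Qed.

Lemma intertwN p : intertw p -> intertw (- p).
Proof.
have -> : - p = (- 1)%:MP * p by rewrite mpolyCN mpolyC1 mulN1r.
by apply: intertwM; apply/intertw_inv/sym_C.
Qed.

Lemma intertwX j : intertw 'X_j.
Proof.
have hx : intertw 'X_strand.
  move=> q; rewrite /bstar BrD BrN !BrE mulr1.
  have -> : Bpure q ('X_strand * 'X_strandS) =
            Bpure (q * ('X_strand * 'X_strandS)) 1.
    by rewrite Bpure_inv ?sym_mul // mulr1.
  rewrite -[X in _ = Bpure _ X - _](addrK 'X_strandS) BpureDr.
  rewrite -[X in _ = Bpure _ X + _ - _]mulr1 -Bpure_inv ?sym_add //.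
  rewrite [Bpure _ (- _)]tensNr -/(Bpure _ _) addrAC.
  congr (_ - _); last by rewrite mulrC.
  rewrite -BpureNl -BpureDl; congr Bpure.
  by ring.
have [->//|jN] := eqVneq j strand.
have [->|jN'] := eqVneq j strandS.
  rewrite -['X_strandS](addKr 'X_strand); apply: intertwD; first exact: intertwN.
  exact/intertw_inv/sym_add.
by apply: intertw_inv; rewrite msym_X tpermD ?eqxx // eq_sym.
Qed.

Lemma bstarr p : intertw p.
Proof.
have hC c : intertw c%:MP by apply/intertw_inv/sym_C.
have h0 : intertw 0 by rewrite -[0]mpolyC0; apply: hC.
have h1 : intertw 1 by rewrite -[1]mpolyC1; apply: hC.
rewrite [p]mpolyE; elim/big_rec: _ => // m q _; apply: intertwD.
rewrite -mul_mpolyC mpolyXE_id; apply: intertwM; first exact: hC.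
elim/big_rec: _ => // j q' _; apply: intertwM.
by elim: (m j) => // a IH; rewrite exprS; apply: intertwM => //; exact: intertwX.
Qed.

Lemma bstar_bil : bilinear_op (fun p q : R => p * q) (fun p q : R => p * q) Bl Br
  bstar.
Proof. by split; [exact: bstarD | exact: bstarl | exact: bstarr]. Qed.

(* [T_ true] is the complex of sigma_i, with R(1) in homological degree -1,   *)
(* and [T_ false] that of its inverse, with R(-1) in homological degree 1;    *)
(* in both cases B_i(1) is in homological degree 0.                           *)
Section Complex.
Variable eps : bool.

Local Notation C := (Bs * R)%type.

Definition Cl (p : R) (c : C) : C := (Bl p c.1, p * c.2).
Definition Cr (p : R) (c : C) : C := (Br p c.1, p * c.2).
Definition Chom (e : degree) (c : C) : Prop :=
  Bhom (e + (0, 1, 0)) c.1 /\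
  R_hom (if eps then e + (0, 1, 1) else e - (0, 1, 1)) c.2.
Definition Csgn (c : C) : C := (c.1, - c.2).
Definition Cb (c : C) : C := (0, b_ c.1).
Definition Cbstar (c : C) : C := (bstar c.2, 0).
Definition Cdif : C -> C := if eps then Cb else Cbstar.
Definition Cxi (j : 'I_n) (c : C) : C :=
  let x := if eps then Cbstar else Cb in
  if j == strand then x c else if j == strandS then - x c else 0.

Lemma Cl_action : is_action Cl.
Proof.
have [[a1 a2 a3 a4] [b1 b2 b3 b4]] := (Bl_action, mulr_is_action).
split=> [[v1 v2]|p q [v1 v2]|p q [v1 v2]|p [v1 v2] [w1 w2]]; congr pair => /=;
  rewrite ?(a1, b1) // ?(a2, b2) // ?(a3, b3) // ?(a4, b4) //.
Qed.
Lemma Cr_action : is_action Cr.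
Proof.
have [[a1 a2 a3 a4] [b1 b2 b3 b4]] := (Br_action, mulr_is_action).
split=> [[v1 v2]|p q [v1 v2]|p q [v1 v2]|p [v1 v2] [w1 w2]]; congr pair => /=;
  rewrite ?(a1, b1) // ?(a2, b2) // ?(a3, b3) // ?(a4, b4) //.
Qed.
Lemma ClrC p q c : Cl p (Cr q c) = Cr q (Cl p c).
Proof. by rewrite /Cl /Cr /= BlrC mulrCA. Qed.
Lemma C_sym p c : p \is symmetric -> Cl p c = Cr p c.
Proof. by move=> sp; rewrite /Cl /Cr B_sym. Qed.

Local Notation bilC := (bilinear_op Cl Cr Cl Cr).

Lemma Csgn_bil : bilC Csgn.
Proof.
split=> [[v1 v2] [w1 w2]|p [v1 v2]|p [v1 v2]]; congr pair => /=.
- by rewrite opprD.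
- by rewrite mulrN.
- by rewrite mulrN.
Qed.

Lemma Bhom_T e x : Bhom e x -> x = 0 \/ e.2 = 0.
Proof.
elim=> [|y z _ hy _ hz|e1 e2 p q /R_hom_T hp /R_hom_T hq <-]; first by left.
  by case: hy hz => [->|hy] [->|hz]; rewrite ?addr0; auto.
case: hp => [->|h1]; first by left; rewrite tens0l.
case: hq => [->|h2]; first by left; rewrite tens0r.
by right; rewrite /= h1 h2.
Qed.

Lemma Csgn_hom e c : Chom e c -> Csgn c = koszul e.2 c.
Proof.
case: c => [x p] [/= /Bhom_T hx /R_hom_T hp].
have hx' : x = 0 \/ e.2 = 0 
  by case: hx => [->|h]; [left | right; rewrite -h /= addr0].
have hp' : p = 0 \/ odd `|e.2|%N.
  by case: hp => [->|h]; [left | right; case: (eps) h => /= h; lia].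
rewrite /koszul /Csgn /=.
case: hp' hx' => [->|h2] [->|h1].
- by case: odd; congr pair; rewrite /= !oppr0.
- by rewrite h1 /= oppr0.
- by rewrite h2; congr pair; rewrite /= oppr0.
- by move: h2; rewrite h1.
Qed.

Lemma Cb_bil : bilC Cb.
Proof.
have [bD bl br] := b_bil.
split=> [[v1 v2] [w1 w2]|p [v1 v2]|p [v1 v2]]; congr pair => /=.
- by rewrite addr0.
- by rewrite bD.
- by apply: (addrI (Bl p 0)); rewrite -BlD !addr0.
- by rewrite bl.
- by apply: (addrI (Br p 0)); rewrite -BrD !addr0.
- by rewrite br.
Qed.

Lemma Cbstar_bil : bilC Cbstar.
Proof.
have [bD bl br] := bstar_bil.
split=> [[v1 v2] [w1 w2]|p [v1 v2]|p [v1 v2]]; congr pair => /=.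
- by rewrite bD.
- by rewrite addr0.
- by rewrite bl.
- by rewrite mulr0.
- by rewrite br.
- by rewrite mulr0.
Qed.

Lemma Cdif_bil : bilC Cdif. Proof. by rewrite /Cdif; case: eps; [exact: Cb_bil | exact: Cbstar_bil]. Qed.

Lemma Cxi_bil j : bilC (Cxi j).
Proof.
have xP : bilC (if eps then Cbstar else Cb)
  by case: eps; [exact: Cbstar_bil | exact: Cb_bil].
rewrite /Cxi; case: eqP => _ //; case: eqP => _; 
  first by apply: bilinearN xP; [exact: Cl_action | exact: Cr_action].
exact: bilinear0 Cl_action Cr_action.
Qed.

Definition T_ : amodule :=
  @AModule C Cl Cr Chom Csgn Cdif Cxi (fun _ _ => 0) Cl_action Cr_action ClrC
    C_sym Csgn_bil Csgn_hom Cdif_bil Cxi_bil (fun=> bilinear0 Cl_action Cr_action).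

End Complex.
End Crossing.

(* A braid word with an arbitrary bracketing. The twisted coproducts are not  *)
(* strictly coassociative, so that the action of u_k on the tensor product    *)
(* depends on the order in which they are iterated.                           *)
Inductive braid : Type :=
| braid1
| sigma (i : nat) of (i.+1 < n)%N & bool
| braidM of braid & braid.

(* The product of permutations is composition of functions, (vw)(i) = v(w(i)),*)
(* which is w * v in MathComp.                                                *)
Fixpoint braid_perm (b : braid) : 'S_n :=
  match b with
  | braid1 => 1%g
  | sigma i lti _ => s_ lti
  | braidM b1 b2 => (braid_perm b2 * braid_perm b1)%g
  end.

(* T_b, w being braid_perm b                                                  *)
Fixpoint rouquier (b : braid) : amodule :=
  match b with
  | braid1 => T1
  | sigma i lti eps => T_ lti eps
  | braidM b1 b2 =>
      atensor (rouquier b1) (rouquier b2) (braid_perm b1) (braid_perm b2)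
  end.

Section Yification.
Variable b : braid.
Local Notation T := (rouquier b).
Local Notation w := (braid_perm b).
Local Notation C_y := {mpoly K[n]}.
Local Notation cT := (fun (c : K) (v : T) => lact c%:MP v).
Local Notation cy := (fun (c : K) (p : C_y) => c *: p).

(* T_b (x)_K K[y_1, .., y_n]                                                  *)
Definition Y : Type := tensor cT cy.
HB.instance Definition _ := GRing.Zmodule.on Y.

Definition Yscale (c : K) : Y -> Y := tmap (cT c) id.

Lemma YscaleE c v p : Yscale c (tens cT cy v p) = tens cT cy (lact c%:MP v) p.
Proof.
apply: tmapE => //; first exact: (actD (lactP _)).
by move=> s m; rewrite -!(actM (lactP _)) mulrC.
Qed.

Lemma YscaleD c : {morph Yscale c : x y / x + y}.
Proof.
apply: tmapD => //; first exact: (actD (lactP _)).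
by move=> s m; rewrite -!(actM (lactP _)) mulrC.
Qed.

Fact Yscale_M (c d : K) z : Yscale c (Yscale d z) = Yscale (c * d) z.
Proof.
elim/tensor_ind: z => [x y hx hy|m k]; first by rewrite !YscaleD hx hy.
by rewrite !YscaleE -(actM (lactP _)) mpolyCM.
Qed.

Fact Yscale_1 : left_id 1 Yscale.
Proof.
elim/tensor_ind => [x y hx hy|m k]; first by rewrite !YscaleD hx hy.
by rewrite !YscaleE mpolyC1 (act1 (lactP _)).
Qed.

Fact Yscale_Dl z : {morph Yscale^~ z : c d / c + d}.
Proof.
move=> c d; elim/tensor_ind: z => [x y hx hy|m k].
  by rewrite !YscaleD hx hy addrACA.
by rewrite !YscaleE mpolyCD (actDl (lactP _)) tensDl.
Qed.

HB.instance Definition _ := GRing.Zmodule_isLmodule.Build K Y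
  Yscale_M Yscale_1 YscaleD Yscale_Dl.

Definition Y_hom : degree -> Y -> Prop :=
  thom (@hom T) (poly_hom (0, -2, -2)).

Definition onT (f : T -> T) : Y -> Y := tmap f id.
Definition ony (g : C_y -> C_y) : Y -> Y := tmap id g.

Definition x_ (i : 'I_n) : Y -> Y := onT (lact 'X_i).
Definition x'_ (i : 'I_n) : Y -> Y := onT (ract 'X_i).
Definition xi_ (i : 'I_n) : Y -> Y := onT (@xi T i).
Definition u_ (k : nat) : Y -> Y := onT (@u T k).
Definition y_ (i : 'I_n) : Y -> Y := ony (fun p => 'X_i * p).
Definition ddy (i : 'I_n) : Y -> Y := ony (mderiv i).

Definition d_y (z : Y) : Y := onT (@dif T) z + \sum_(i < n) xi_ i (y_ i z).

(* h_m(x_i, x'_(w^-1(i)))                                                     *)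
Definition h_xx' (m : int) (i : 'I_n) : Y -> Y :=
  hsym m [:: x_ i; x'_ ((w^-1)%g i)].

Definition F (k : nat) (z : Y) : Y :=
  \sum_(i < n) h_xx' (k%:Z - 1) i (ddy i z) + u_ k z.

End Yification.
End AModules.

(* Main.v *)
(** The commutator of [xi_i y_i] with [h_(k-1)(x_i, x'_(w^-1(i))) d/dy_i] is
    [- h_(k-1)(x_i, x'_(w^-1(i))) xi_i], so that [d_y] commutes with [F_k] as soon
    as [d u_k = sum_i h_(k-1)(x_i, x'_(w^-1(i))) xi_i] holds on [T_b]; likewise
    the other identities reduce to the relations of [A_w] for the action on
    [T_b].  For one crossing, [xi_i] factors through [R], where left and right
    multiplication agree, so the symmetry of [h_(k-1)] gives [d u_k = 0].  The
    twisted coproduct preserves the relations, by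
    [(x - x') h_(k-2)(x, x', x'') = h_(k-1)(x, x'') - h_(k-1)(x', x'')]. *)

From mathcomp Require Import all_boot all_order all_fingroup all_algebra.
From mathcomp Require Import mpoly reals complex zify.
Require Import Defs.

Set Implicit Arguments.
Unset Strict Implicit.
Unset Printing Implicit Defensive.

Import GRing.Theory.
Local Open Scope ring_scope.

(** * Complete symmetric polynomials in commuting operators *)

(** The obstacle is that [u_k (x) 1 + 1 (x) u_k] alone does not satisfy the relation: its
    differential has coefficients [h_(k-1)(x, x')] on the left factor and [h_(k-1)(x', x'')] on the
    right, whereas both should be [h_(k-1)(x, x'')]. The differential of the quadratic term
    [xi (x) xi] supplies exactly the two missing differences. Since the iterated action of [u_k]
    depends on the bracketing, the relations of [A_w] are carried as an invariant through an
    induction on bracketed words; no coassociativity enters. Koszul signs are expressed through the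
    operator [sgn], so that identities can be checked on all pure tensors, homogeneous or not. *)

Section AdditiveMaps.
Variables (V W : zmodType) (f : V -> W).
Hypothesis fD : {morph f : x y / x + y}.

Lemma morphD0 : f 0 = 0.
Proof. by apply: (addrI (f 0)); rewrite -fD !addr0. Qed.

Lemma morphDN x : f (- x) = - f x.
Proof. by apply: (addrI (f x)); rewrite -fD !subrr morphD0. Qed.

Lemma morphDB x y : f (x - y) = f x - f y.
Proof. by rewrite fD morphDN. Qed.

Lemma morphD_sum (I : Type) (r : seq I) (P : pred I) (G : I -> V) :
  f (\sum_(i <- r | P i) G i) = \sum_(i <- r | P i) f (G i).
Proof. exact: (big_morph f fD morphD0). Qed.

End AdditiveMaps.

Section CompleteSymmetric.
Variable V : zmodType.
Implicit Types (f g h : V -> V) (fs : seq (V -> V)) (m : int).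

(** The monomials are split by whether [f] occurs. Since [h] vanishes in negative degrees, the
    recurrence holds for every integer [m], which later covers [h_(k-2)] at [k = 1]. *)
Lemma hsym_cons m f fs v : {morph f : x y / x + y} ->
  hsym m (f :: fs) v = hsym m fs v + f (hsym (m - 1) (f :: fs) v).
Proof.
move=> fD; case: m => [[|m]|m].
- by rewrite sub0r /= big_ord_recl big_ord0 (morphD0 fD).
- rewrite -(addn1 m) PoszD addrK /= addn1 big_ord_recl subn0; congr (_ + _).
  by rewrite (morphD_sum fD).
- by rewrite (_ : Negz m - 1 = Negz m.+1) ?[hsym (Negz _) _ _]/= ?(morphD0 fD) ?addr0 //; lia.
Qed.

(** Serves two purposes: commuting [h] past an operator on one module, and carrying [h] from a
    factor into a tensor product along [m |-> m (x) k]. *)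
Lemma hsym_map (W : zmodType) (phi : V -> W) m fs (gs : seq (W -> W)) v :
  {morph phi : x y / x + y} ->
  List.Forall2 (fun f (g : W -> W) => forall x, phi (f x) = g (phi x)) fs gs ->
  phi (hsym m fs v) = hsym m gs (phi v).
Proof.
move=> phiD fg; case: m => m; last exact: morphD0.
rewrite /hsym; elim: fg m => [|f g {}fs {}gs fgE _ IH] m /=.
  by case: ifP => _; rewrite ?(morphD0 phiD).
rewrite (morphD_sum phiD); apply: eq_bigr => a _; rewrite -IH.
by move: (hsym_nat _ fs v) => y; elim: (val a) => //= b <-.
Qed.

Lemma hsym_additive m fs :
  List.Forall (fun f => {morph f : x y / x + y}) fs ->
  {morph hsym m fs : x y / x + y}.
Proof.
case: m => m fsD x y; last by rewrite addr0.
rewrite /hsym; elim: fsD m => [|f {}fs fD _ IH] m /=.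
  by case: ifP => _; rewrite ?addr0.
rewrite -big_split; apply: eq_bigr => a _; rewrite IH.
by elim: (val a) (hsym_nat _ fs x) (hsym_nat _ fs y) => //= b IHb x' y'; rewrite IHb fD.
Qed.

(** [hsym] recurses on the list, so symmetry in the variables is not built in. *)
Lemma hsym_swap m f g fs v :
  {morph f : x y / x + y} -> {morph g : x y / x + y} ->
  (forall x, f (g x) = g (f x)) ->
  hsym m [:: f, g & fs] v = hsym m [:: g, f & fs] v.
Proof.
move=> fD gD fgC; case: m => m //.
(* Expanding in both variables lowers the degree by two, so two consecutive degrees are carried
   through the induction. *)
suff: hsym (m%:Z - 1) [:: f, g & fs] v = hsym (m%:Z - 1) [:: g, f & fs] v /\
      hsym m [:: f, g & fs] v = hsym m [:: g, f & fs] v by case.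
elim: m => [|m [IH1 IH]].
  by split; [rewrite sub0r | rewrite /hsym /= !big_ord1].
rewrite -addn1 PoszD addrK; split=> //.
rewrite [LHS]hsym_cons // [RHS]hsym_cons // addrK -IH.
rewrite [hsym _ (g :: fs) v]hsym_cons // [hsym _ (f :: fs) v]hsym_cons // addrK.
have eqg : hsym m (g :: fs) v =
    hsym m [:: f, g & fs] v - f (hsym (m%:Z - 1) [:: f, g & fs] v).
  by rewrite [X in X - _]hsym_cons // addrK.
have eqf : hsym m (f :: fs) v =
    hsym m [:: f, g & fs] v - g (hsym (m%:Z - 1) [:: f, g & fs] v).
  by rewrite IH IH1 [X in X - _]hsym_cons // addrK.
rewrite eqg eqf (morphDB gD) (morphDB fD) fgC -!addrA; congr (_ + _).
by rewrite addrCA [RHS]addrCA; congr (_ + _); rewrite addrC.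
Qed.

Lemma hsym_swap_tail m f g h v :
  {morph g : x y / x + y} -> {morph h : x y / x + y} ->
  (forall x, g (h x) = h (g x)) ->
  hsym m [:: f; g; h] v = hsym m [:: f; h; g] v.
Proof.
case: m => m // gD hD ghC; rewrite /hsym [LHS]/hsym_nat -/hsym_nat.
apply: eq_bigr => a _; congr iter.
exact: (hsym_swap (m - a)%N [::] v gD hD ghC).
Qed.

(** Expand the same [h_m(f, g, fs)] by its first variable in either order of [f] and [g], and equate
    the results. *)
Lemma hsym_diff m f g fs v :
  {morph f : x y / x + y} -> {morph g : x y / x + y} ->
  (forall x, f (g x) = g (f x)) ->
  f (hsym (m - 1) [:: f, g & fs] v) - g (hsym (m - 1) [:: f, g & fs] v) =
  hsym m (f :: fs) v - hsym m (g :: fs) v.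
Proof.
move=> fD gD fgC; have := hsym_swap m fs v fD gD fgC.
rewrite hsym_cons // [RHS]hsym_cons // -(hsym_swap (m - 1) fs v fD gD fgC).
by move=> e; apply/eqP; rewrite subr_eq addrAC -e addrC addKr.
Qed.

(** Symmetry brings [g] and [h] to the front, where [hsym_diff] applies. This version handles the
    factor [x' - x''] produced by the right tensor factor. *)
Lemma hsym_diff_tail m f g h v :
  {morph f : x y / x + y} -> {morph g : x y / x + y} ->
  {morph h : x y / x + y} ->
  (forall x, f (g x) = g (f x)) -> (forall x, f (h x) = h (f x)) ->
  (forall x, g (h x) = h (g x)) ->
  g (hsym (m - 1) [:: f; g; h] v) - h (hsym (m - 1) [:: f; g; h] v) =
  hsym m [:: f; g] v - hsym m [:: f; h] v.
Proof.
move=> fD gD hD fgC fhC ghC; rewrite hsym_swap // hsym_swap_tail // hsym_diff //.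
by rewrite [hsym m [:: g; f] v]hsym_swap // [hsym m [:: h; f] v]hsym_swap.
Qed.

End CompleteSymmetric.

(** * Homogeneous operators *)

Section Homogeneous.
Variables (V : zmodType) (homV : degree -> V -> Prop).
Hypothesis homV0 : forall e, homV e 0.
Hypothesis homVD : forall e x y, homV e x -> homV e y -> homV e (x + y).
Local Notation hop := (homog_op homV).

Lemma homog_comp d d1 d2 (f g : V -> V) : d = d2 + d1 ->
  hop d1 f -> hop d2 g -> hop d (fun x => f (g x)).
Proof. by move=> -> fh gh e x hx; rewrite addrA; apply/fh/gh. Qed.

Lemma homog_add d (f g : V -> V) :
  hop d f -> hop d g -> hop d (fun x => f x + g x).
Proof. by move=> fh gh e x hx; apply: homVD; [apply: fh | apply: gh]. Qed.

Lemma homog_sum (I : finType) d (f : I -> V -> V) :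
  (forall i, hop d (f i)) -> hop d (fun x => \sum_i f i x).
Proof.
move=> fh e x hx; elim/big_ind: _ => [|y z|i _]; [exact: homV0 | exact: homVD | exact: fh].
Qed.

(** For negative [m] the operator is zero, hence homogeneous of any degree, including the formal
    [2 * m]. *)
Lemma homog_hsym m (fs : seq (V -> V)) : List.Forall (hop (0, 2, 0)) fs ->
  hop (0, 2 * m, 0) (hsym m fs).
Proof.
move=> fsh; case: m => m e x hx; last exact: homV0.
rewrite /hsym; elim: fsh m e x hx => [|f {}fs fh _ IH] m e x hx /=.
  case: eqP => [->|_]; last exact: homV0.
  by rewrite mulr0 -[(0, 0, 0)]/(0 : degree) addr0.
elim/big_ind: _ => [|y z|a _]; [exact: homV0 | exact: homVD |].
have /(_ (m - a)%N) := IH _ e x hx; move: (hsym_nat _ fs x) => y.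
have -> : e + (0, 2 * m%:Z, 0) = e + (0, 2 * (m - a)%N%:Z, 0) + (0, 2 * a%:Z, 0).
  rewrite -addrA; congr (_ + _); congr (_, _, _) => //=.
  by case: a => a /=; lia.
move: (e + _) => e'; elim: (val a) => [|b IHb] hy /=.
  by rewrite mulr0 -[(0, 0, 0)]/(0 : degree) addr0.
rewrite (_ : (0, 2 * b.+1%:Z, 0) = (0, 2 * b%:Z, 0) + (0, 2, 0) :> degree).
  by rewrite addrA; apply/fh/IHb.
by congr (_, _, _); rewrite //=; lia.
Qed.

End Homogeneous.

Section TensorHomogeneous.
Variables (S : Type) (M N : zmodType) (rho : S -> M -> M) (lam : S -> N -> N).
Variables (homM : degree -> M -> Prop) (homN : degree -> N -> Prop).
Local Notation hom := (@thom _ _ _ rho lam homM homN).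

Lemma thom_morph (A : zmodType) (homA : degree -> A -> Prop) d
    (phi : tensor rho lam -> A) :
  (forall e, homA e 0) ->
  (forall e x y, homA e x -> homA e y -> homA e (x + y)) ->
  {morph phi : x y / x + y} ->
  (forall e1 e2 m n, homM e1 m -> homN e2 n ->
    homA (e1 + e2 + d) (phi (tens rho lam m n))) ->
  forall e t, hom e t -> homA (e + d) (phi t).
Proof.
move=> hA0 hAD phiD phih e t; elim=> [|x y _ hx _ hy|e1 e2 m k hm hk <-].
- by rewrite (morphD0 phiD).
- by rewrite phiD; apply: hAD.
- exact: phih.
Qed.

Lemma thomN : (forall e m, homM e m -> homM e (- m)) ->
  forall e t, hom e t -> hom e (- t).
Proof.
move=> hN e t ht; rewrite -[e]addr0; apply: (thom_morph _ _ _ _ ht).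
- exact: thom0.
- exact: thomD.
- exact: opprD.
- move=> e1 e2 m k hm hk; rewrite -tensNl; apply: (thom_tens _ _ (e1 := e1) (e2 := e2)) => //.
    exact: hN.
  by rewrite addr0.
Qed.

Lemma thom_tmap d1 d2 d (f : M -> M) (g : N -> N) : d = d1 + d2 ->
  {morph (tmap f g : tensor rho lam -> tensor rho lam) : x y / x + y} ->
  (forall m k, tmap f g (tens rho lam m k) = tens rho lam (f m) (g k)) ->
  homog_op homM d1 f -> homog_op homN d2 g -> homog_op hom d (tmap f g).
Proof.
move=> -> fgD fgE fh gh e t; apply: thom_morph => //.
- exact: thom0.
- exact: thomD.
- move=> e1 e2 m k hm hk; rewrite fgE.
  by apply: (thom_tens _ _ (fh _ _ hm) (gh _ _ hk)); rewrite addrACA.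
Qed.

End TensorHomogeneous.

Lemma degree_natmul (a b c : int) d :
  (a, b, c) *+ d = (a *+ d, b *+ d, c *+ d) :> degree.
Proof. by elim: d => // d IH; rewrite !mulrS IH. Qed.

Section PolynomialHomogeneous.
Variables (n : nat) (K : fieldType) (delta : degree).
Hypothesis deltaI : injective (GRing.natmul delta).
Local Notation phom := (@poly_hom n K delta).

(** A sum needs a single polynomial degree; injectivity of [d |-> delta *+ d] makes [e] determine
    it. *)
Lemma poly_homD e p q : phom e p -> phom e q -> phom e (p + q).
Proof.
case=> [->|[d -> hp]]; first by rewrite add0r.
case=> [->|[d' /deltaI <- hq]]; first by rewrite addr0; right; exists d.
by right; exists d => //; apply: dhomogD.
Qed.

Lemma poly_homN e p : phom e p -> phom e (- p).
Proof.
case=> [->|[d -> hp]]; first by left; rewrite oppr0.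
by right; exists d; rewrite ?dhomogN.
Qed.

Lemma poly_homM e1 e2 p q : phom e1 p -> phom e2 q -> phom (e1 + e2) (p * q).
Proof.
case=> [->|[d1 -> hp]]; first by left; rewrite mul0r.
case=> [->|[d2 -> hq]]; first by left; rewrite mulr0.
by right; exists (d1 + d2)%N; [rewrite mulrnDr | apply: dhomogM].
Qed.

Lemma poly_homX i : phom delta 'X_i.
Proof. by right; exists 1%N => //; rewrite dhomogX /= mdeg1. Qed.

Lemma poly_hom1 : phom 0 1.
Proof. by right; exists 0%N => //; apply: dhomog1. Qed.

Lemma poly_hom_mderiv i : homog_op phom (- delta) (mderiv i).
Proof.
move=> e p [->|[[|d] -> /dhomogP hp]]; first by left; rewrite mderiv0.
(* In polynomial degree 0 the derivative vanishes; the case is separate because [- delta] need not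
   be a natural multiple of [delta]. *)
- left; apply/mpolyP => m; rewrite mcoeff0 mcoeff_deriv.
  have [/hp|] := boolP (m + U_(i) \in msupp p)%MM; first by rewrite /= mdegD mdeg1 addn1.
  by move=> /memN_msupp_eq0 ->; rewrite mul0rn.
- right; exists d; first by rewrite mulrSr addrK.
  apply/dhomogP => m; rewrite mcoeff_msupp mcoeff_deriv => hm.
  have /hp /= : (m + U_(i))%MM \in msupp p.
    by rewrite mcoeff_msupp; apply: contraNneq hm => ->; rewrite mul0rn.
  by rewrite mdegD mdeg1 addn1 => -[].
Qed.

End PolynomialHomogeneous.

(** * The relations of A_w *)

Section TensorOperators.
Variables (S : Type) (M N : zmodType) (rho : S -> M -> M) (lam : S -> N -> N).

Lemma tensor_ext (A : zmodType) (f g : tensor rho lam -> A) :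
  {morph f : x y / x + y} -> {morph g : x y / x + y} ->
  (forall m k, f (tens rho lam m k) = g (tens rho lam m k)) -> f =1 g.
Proof. by move=> fD gD fg; elim/tensor_ind=> // x y hx hy; rewrite fD gD hx hy. Qed.

End TensorOperators.

Section DgModules.
Variables (K : fieldType) (n : nat).
Local Notation amodule := (amodule K n).

Local Notation bilinear_end M f :=
  (bilinear_op (@lact _ _ M) (@ract _ _ M) (@lact _ _ M) (@ract _ _ M) f).

(** The invariant of the induction on braid words. The [sgn] clauses state that [dif] and [xi] are
    odd and [u] is even; they produce the Koszul signs on tensor products. *)
Record dg_module (M : amodule) (w : 'S_n) : Prop := {
  sgnK : forall v : M, sgn (sgn v) = v;
  sgn_dif : forall v : M, sgn (dif v) = - dif (sgn v);
  sgn_xi : forall i (v : M), sgn (xi i v) = - xi i (sgn v);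
  sgn_u : forall k (v : M), sgn (u k v) = u k (sgn v);
  xi_xi : forall i j (v : M), xi i (xi j v) = - xi j (xi i v);
  dif_xi : forall i (v : M),
    dif (xi i v) + xi i (dif v) = lact 'X_i v - ract 'X_((w^-1)%g i) v;
  dif_u : forall k (v : M),
    dif (u k v) - u k (dif v) = \sum_(i < n)
      hsym (k%:Z - 1) [:: @lact _ _ M 'X_i; @ract _ _ M 'X_((w^-1)%g i)] (xi i v);
  u_xi : forall k i (v : M), u k (xi i v) = xi i (u k v);
  u_u : forall k m (v : M), u k (u m v) = u m (u k v)
}.

(** * The relations on a tensor product, under the twisted coproduct *)

Section Tensor.
Variables (M N : amodule) (v w : 'S_n).
Hypotheses (dgM : dg_module M v) (dgN : dg_module N w).

Local Notation T := (tensor (@ract _ _ M) (@lact _ _ N)).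
Local Notation pure m k := (tens (@ract _ _ M) (@lact _ _ N) m k).
Local Notation "f ** g" :=
  (tmap f g : T -> T) (at level 40, no associativity).
Local Notation bilM f := (bilinear_end M f).
Local Notation bilN f := (bilinear_end N f).

(** A tensor product carries three commuting actions of [R], and [h_(k-2)(x, x', x'')] involves the
    middle one, which bimodule linearity does not see. *)
Definition trilinear (f : T -> T) : Prop :=
  bilinear_op (@atl _ _ M N) (@atr _ _ M N) (@atl _ _ M N) (@atr _ _ M N) f /\
  forall p t, f (atm p t) = atm p (f t).

Lemma trilinear_additive f : trilinear f -> {morph f : x y / x + y}.
Proof. by case=> -[]. Qed.

Lemma tmap_pure f g m k : bilM f -> bilN g -> (f ** g) (pure m k) = pure (f m) (g k).
Proof. by move=> [fD _ fr] [gD gl _]; apply: tmapE. Qed.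

Lemma atm_pure p m k : atm p (pure m k) = pure (ract p m) k.
Proof.
apply: tmap_pure => //; split=> [x y|q x|q x]; first exact: (actD (ractP M)).
  by rewrite lractC.
by rewrite -!(actM (ractP M)) mulrC.
Qed.

Lemma tmap_trilinear f g : bilM f -> bilN g -> trilinear (f ** g).
Proof.
move=> fB gB; have fgB := tmap_bil fB gB; split=> // p.
have [fgD _ _] := fgB; have [mD _ _] := @atm_bil _ _ M N p.
apply: tensor_ext => [x y|x y|m k]; rewrite ?(fgD, mD) //.
by rewrite atm_pure !tmap_pure // atm_pure; have [_ _ ->] := fB.
Qed.

Lemma idM_bil : bilM id. Proof. by []. Qed.
Lemma idN_bil : bilN id. Proof. by []. Qed.
Lemma compM_bil f g : bilM f -> bilM g -> bilM (f \o g).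
Proof. exact: bilinear_comp. Qed.

Local Notation D1 := (@dif _ _ M ** id).
Local Notation D2 := (@sgn _ _ M ** @dif _ _ N).
Local Notation X1 i := (@xi _ _ M i ** id).
Local Notation X2 j := (@sgn _ _ M ** @xi _ _ N j).
Local Notation U1 k := (@u _ _ M k ** id).
Local Notation U2 k := (id ** @u _ _ N k).
Local Notation s := (@tsgn _ _ M N).
Local Notation UT := (@tu _ _ M N v w).
Local Notation XT := (@txi _ _ M N v).
Local Notation A i := (@atl _ _ M N 'X_i).
Local Notation B i := (@atm _ _ M N 'X_i).
Local Notation C i := (@atr _ _ M N 'X_i).

Lemma D1_tri : trilinear D1.
Proof. exact: tmap_trilinear (dif_bilinear M) idN_bil. Qed.
Lemma D2_tri : trilinear D2.
Proof. exact: tmap_trilinear (sgn_bilinear M) (dif_bilinear N). Qed.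
Lemma X1_tri i : trilinear (X1 i).
Proof. exact: tmap_trilinear (xi_bilinear _ i) idN_bil. Qed.
Lemma X2_tri i : trilinear (X2 i).
Proof. exact: tmap_trilinear (sgn_bilinear M) (xi_bilinear _ i). Qed.
Lemma U1_tri k : trilinear (U1 k).
Proof. exact: tmap_trilinear (u_bilinear _ k) idN_bil. Qed.
Lemma U2_tri k : trilinear (U2 k).
Proof. exact: tmap_trilinear idM_bil (u_bilinear _ k). Qed.
Lemma s_tri : trilinear s.
Proof. exact: tmap_trilinear (sgn_bilinear M) (sgn_bilinear N). Qed.

Lemma ractM_bil p : bilM (ract p).
Proof. exact: bilinear_ract (ractP M) (@lractC _ _ M) p. Qed.

Lemma A_tri p : trilinear (@atl _ _ M N p).
Proof.
split; first exact: bilinear_lact (tl_action M N) (@atlrC _ _ M N) p.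
by move=> q t; have [_ ->] := @atm_bil _ _ M N q.
Qed.

Lemma B_tri p : trilinear (@atm _ _ M N p).
Proof. exact: tmap_trilinear (ractM_bil p) idN_bil. Qed.

Lemma C_tri p : trilinear (@atr _ _ M N p).
Proof.
split; first exact: bilinear_ract (tr_action M N) (@atlrC _ _ M N) p.
by move=> q t; have [_ _ ->] := @atm_bil _ _ M N q.
Qed.

Lemma trilinear_hsym f m i j l t : trilinear f ->
  f (hsym m [:: A i; B j; C l] t) = hsym m [:: A i; B j; C l] (f t).
Proof.
case=> -[fD fl fr] fm; apply: hsym_map => //.
by do !constructor; move=> x; rewrite ?fl ?fr ?fm.
Qed.

Lemma tmap_comm f g f' g' : bilM f -> bilN g -> bilM f' -> bilN g' ->
  (forall m k, pure (f (f' m)) (g (g' k)) = pure (f' (f m)) (g' (g k))) ->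
  forall t, (f ** g) ((f' ** g') t) = (f' ** g') ((f ** g) t).
Proof.
move=> fB gB fB' gB' E.
have D := trilinear_additive (tmap_trilinear fB gB).
have D' := trilinear_additive (tmap_trilinear fB' gB').
by apply: tensor_ext => [x y|x y|m k]; rewrite ?D' ?D ?D' // !tmap_pure ?E.
Qed.

Lemma tmap_anticomm f g f' g' : bilM f -> bilN g -> bilM f' -> bilN g' ->
  (forall m k, pure (f (f' m)) (g (g' k)) = - pure (f' (f m)) (g' (g k))) ->
  forall t, (f ** g) ((f' ** g') t) = - (f' ** g') ((f ** g) t).
Proof.
move=> fB gB fB' gB' E.
have D := trilinear_additive (tmap_trilinear fB gB).
have D' := trilinear_additive (tmap_trilinear fB' gB').
by apply: tensor_ext => [x y|x y|m k]; rewrite ?D' ?D ?D' ?opprD // !tmap_pure ?E.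
Qed.

#[local] Hint Resolve dif_bilinear sgn_bilinear xi_bilinear u_bilinear
  idM_bil idN_bil : core.

(** Odd operators on different factors anticommute: the one on the right carries [sgn] on the left
    factor, and [sgn] anticommutes with odd operators there. *)
Lemma D1_X2 j t : D1 (X2 j t) = - X2 j (D1 t).
Proof.
by apply: tmap_anticomm => // m k; rewrite (sgn_dif dgM) tensNl opprK.
Qed.

Lemma D2_X1 i t : D2 (X1 i t) = - X1 i (D2 t).
Proof. by apply: tmap_anticomm => // m k; rewrite (sgn_xi dgM) tensNl. Qed.

Lemma D1_U2 k t : D1 (U2 k t) = U2 k (D1 t).
Proof. exact: tmap_comm. Qed.

Lemma D2_U1 k t : D2 (U1 k t) = U1 k (D2 t).
Proof. by apply: tmap_comm => // m l; rewrite (sgn_u dgM). Qed.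

Lemma X1_X1 i j t : X1 i (X1 j t) = - X1 j (X1 i t).
Proof. by apply: tmap_anticomm => // m k; rewrite (xi_xi dgM) tensNl. Qed.

Lemma X2_X1 i j t : X2 j (X1 i t) = - X1 i (X2 j t).
Proof. by apply: tmap_anticomm => // m k; rewrite (sgn_xi dgM) tensNl. Qed.

Lemma X1_X2 i j t : X1 i (X2 j t) = - X2 j (X1 i t).
Proof. by rewrite X2_X1 opprK. Qed.

Lemma X2_X2 i j t : X2 i (X2 j t) = - X2 j (X2 i t).
Proof. by apply: tmap_anticomm => // m k; rewrite (xi_xi dgN) tensNr. Qed.

Lemma U1_X1 k i t : U1 k (X1 i t) = X1 i (U1 k t).
Proof. by apply: tmap_comm => // m l; rewrite (u_xi dgM). Qed.

Lemma U1_X2 k i t : U1 k (X2 i t) = X2 i (U1 k t).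
Proof. by apply: tmap_comm => // m l; rewrite (sgn_u dgM). Qed.

Lemma U2_X1 k i t : U2 k (X1 i t) = X1 i (U2 k t).
Proof. exact: tmap_comm. Qed.

Lemma U2_X2 k i t : U2 k (X2 i t) = X2 i (U2 k t).
Proof. by apply: tmap_comm => // m l; rewrite (u_xi dgN). Qed.

Lemma U1_U1 k m t : U1 k (U1 m t) = U1 m (U1 k t).
Proof. by apply: tmap_comm => // x y; rewrite (u_u dgM). Qed.

Lemma U1_U2 k m t : U1 k (U2 m t) = U2 m (U1 k t).
Proof. exact: tmap_comm. Qed.

Lemma U2_U2 k m t : U2 k (U2 m t) = U2 m (U2 k t).
Proof. by apply: tmap_comm => // x y; rewrite (u_u dgN). Qed.

Lemma s_D1 t : s (D1 t) = - D1 (s t).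
Proof. by apply: tmap_anticomm => // m k; rewrite (sgn_dif dgM) tensNl. Qed.

Lemma s_D2 t : s (D2 t) = - D2 (s t).
Proof. by apply: tmap_anticomm => // m k; rewrite (sgn_dif dgN) tensNr. Qed.

Lemma s_X1 i t : s (X1 i t) = - X1 i (s t).
Proof. by apply: tmap_anticomm => // m k; rewrite (sgn_xi dgM) tensNl. Qed.

Lemma s_X2 i t : s (X2 i t) = - X2 i (s t).
Proof. by apply: tmap_anticomm => // m k; rewrite (sgn_xi dgN) tensNr. Qed.

Lemma s_U1 k t : s (U1 k t) = U1 k (s t).
Proof. by apply: tmap_comm => // m l; rewrite (sgn_u dgM). Qed.

Lemma s_U2 k t : s (U2 k t) = U2 k (s t).
Proof. by apply: tmap_comm => // m l; rewrite (sgn_u dgN). Qed.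

(** Writes the Koszul-signed [xi_i (x) xi_j] as a composite, so that its commutation relations
    follow from those of [X1] and [X2]. *)
Lemma xi_sgn_xi i j t : ((@xi _ _ M i \o @sgn _ _ M) ** @xi _ _ N j) t = X1 i (X2 j t).
Proof.
have Q_tri : trilinear ((@xi _ _ M i \o @sgn _ _ M) ** @xi _ _ N j).
  by apply: tmap_trilinear => //; apply: compM_bil.
move: t; apply: tensor_ext => [x y|x y|m k].
- exact: trilinear_additive.
- by rewrite (trilinear_additive (X2_tri j)) (trilinear_additive (X1_tri i)).
- by rewrite !tmap_pure //; apply: compM_bil.
Qed.

Let addA i := trilinear_additive (A_tri 'X_i).
Let addB i := trilinear_additive (B_tri 'X_i).
Let addC i := trilinear_additive (C_tri 'X_i).
Let addX1 i := trilinear_additive (X1_tri i).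
Let addX2 i := trilinear_additive (X2_tri i).

Lemma tdif_tri : trilinear (@tdif _ _ M N).
Proof.
split; first exact: tdif_bil.
move=> p t; have [_ D1m] := D1_tri; have [_ D2m] := D2_tri.
by rewrite /tdif D1m D2m (trilinear_additive (B_tri p)).
Qed.

Let tdifD := trilinear_additive tdif_tri.

Lemma tdif_X1 i t :
  tdif (X1 i t) + X1 i (tdif t) = A i t - B ((v^-1)%g i) t.
Proof.
rewrite /tdif addX1 D2_X1 addrACA addNr addr0; move: t.
apply: tensor_ext => [x y|x y|m k].
- by rewrite (addX1 i) !(trilinear_additive D1_tri) (addX1 i) addrACA.
- by rewrite (addA i) (addB _) opprD addrACA.
- by rewrite !tmap_pure // -tensDl (dif_xi dgM) atlE atm_pure tensDl tensNl.
Qed.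

Lemma tdif_X2 j t :
  tdif (X2 j t) + X2 j (tdif t) = B j t - C ((w^-1)%g j) t.
Proof.
rewrite /tdif addX2 D1_X2 addrACA addNr add0r; move: t.
apply: tensor_ext => [x y|x y|m k].
- by rewrite (addX2 j) !(trilinear_additive D2_tri) (addX2 j) addrACA.
- by rewrite (addB _) (addC _) opprD addrACA.
(* The [sgn] of [D2] and that of [X2] cancel on the left factor; the left action on [N] becomes the
   middle action by balancedness. *)
- rewrite !tmap_pure // !(sgnK dgM) -tensDr (dif_xi dgN) atrE atm_pure.
  by rewrite tensA tensDr tensNr.
Qed.

Lemma tdif_U1 k t : tdif (U1 k t) - U1 k (tdif t) =
  \sum_(i < n) hsym (k%:Z - 1) [:: A i; B ((v^-1)%g i)] (X1 i t).
Proof.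
have addU := trilinear_additive (U1_tri k).
have addD := trilinear_additive D1_tri.
rewrite /tdif addU D2_U1 opprD addrACA subrr addr0; move: t.
apply: tensor_ext => [x y|x y|m l].
- by rewrite addU !addD addU opprD addrACA.
- rewrite -big_split; apply: eq_bigr => i _.
  by rewrite addX1 hsym_additive //; do !constructor.
- rewrite !tmap_pure // -tensNl -tensDl (dif_u dgM).
  have tl m1 m2 := tensDl (@ract _ _ M) (@lact _ _ N) m1 m2 l.
  rewrite (morphD_sum (f := fun m => pure m l) tl); apply: eq_bigr => i _.
  rewrite tmap_pure //; apply: (hsym_map (phi := fun m => pure m l)) => //.
  by do !constructor; move=> x; rewrite ?atlE ?atm_pure.
Qed.

Lemma tdif_U2 k t : tdif (U2 k t) - U2 k (tdif t) =
  \sum_(j < n) hsym (k%:Z - 1) [:: B j; C ((w^-1)%g j)] (X2 j t).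
Proof.
have addU := trilinear_additive (U2_tri k).
have addD := trilinear_additive D2_tri.
rewrite /tdif addU D1_U2 opprD addrACA subrr add0r; move: t.
apply: tensor_ext => [x y|x y|m l].
- by rewrite addU !addD addU opprD addrACA.
- rewrite -big_split; apply: eq_bigr => i _.
  by rewrite addX2 hsym_additive //; do !constructor.
- rewrite !tmap_pure // -tensNr -tensDr (dif_u dgN).
  have tr k1 k2 := tensDr (@ract _ _ M) (@lact _ _ N) (sgn m) k1 k2.
  rewrite (morphD_sum (f := fun k => pure (sgn m) k) tr); apply: eq_bigr => i _.
  rewrite tmap_pure //; apply: (hsym_map (phi := fun k => pure (sgn m) k)) => //.
  by do !constructor; move=> x; rewrite ?atrE ?atm_pure ?tensA.
Qed.

Lemma tuE k t : UT k t = U1 k t + U2 k t + \sum_(i < n)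
  hsym (k%:Z - 2) [:: A i; B ((v^-1)%g i); C ((w^-1)%g ((v^-1)%g i))]
    (X1 i (X2 ((v^-1)%g i) t)).
Proof. by congr (_ + _); apply: eq_bigr => i _; rewrite xi_sgn_xi. Qed.

(** Trilinearity takes [f] through the coefficients [h_(k-2)], so commuting with the three
    constituents of [u_k] suffices. *)
Lemma tri_tu_comm k f : trilinear f ->
  (forall t, U1 k (f t) = f (U1 k t)) -> (forall t, U2 k (f t) = f (U2 k t)) ->
  (forall i j t, X1 i (X2 j (f t)) = f (X1 i (X2 j t))) ->
  forall t, UT k (f t) = f (UT k t).
Proof.
move=> f_tri f1 f2 f12 t; have fD := trilinear_additive f_tri.
rewrite !tuE !fD f1 f2 (morphD_sum fD); congr (_ + _).
by apply: eq_bigr => i _; rewrite f12 trilinear_hsym.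
Qed.

(** An odd operator meets two odd operators in the quadratic term of [u_k], and the two signs
    cancel. *)
Lemma tu_X1 k i t : UT k (X1 i t) = X1 i (UT k t).
Proof.
apply: (tri_tu_comm (X1_tri i)) => [t'|t'|i' j t'].
- exact: U1_X1.
- exact: U2_X1.
- by rewrite X2_X1 (morphDN (addX1 _)) X1_X1 opprK.
Qed.

Lemma tu_X2 k j t : UT k (X2 j t) = X2 j (UT k t).
Proof.
apply: (tri_tu_comm (X2_tri j)) => [t'|t'|i j' t'].
- exact: U1_X2.
- exact: U2_X2.
- by rewrite X2_X2 (morphDN (addX1 _)) X1_X2 opprK.
Qed.

Lemma tu_tri k : trilinear (UT k).
Proof.
split; first exact: tu_bil.
move=> p t; apply: (tri_tu_comm (B_tri p)) => [t'|t'|i j t'].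
- by have [_ ->] := U1_tri k.
- by have [_ ->] := U2_tri k.
- by have [_ X2m] := X2_tri j; have [_ X1m] := X1_tri i; rewrite X2m X1m.
Qed.

Lemma tu_tu k m t : UT k (UT m t) = UT m (UT k t).
Proof.
(* The criterion is used twice: here with [u_m] against the constituents of [u_k], then below with
   those constituents against [u_m]. *)
apply: (tri_tu_comm (tu_tri m)) => [t'|t'|i j t']; last by rewrite tu_X1 tu_X2.
- rewrite (tri_tu_comm (U1_tri k)) // => [x|x|i j x].
  + exact: U1_U1.
  + by rewrite U1_U2.
  + by rewrite U1_X1 U1_X2.
- rewrite (tri_tu_comm (U2_tri k)) // => [x|x|i j x].
  + exact: U1_U2.
  + exact: U2_U2.
  + by rewrite U2_X1 U2_X2.
Qed.

Lemma tsgn_tu k t : s (UT k t) = UT k (s t).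
Proof.
rewrite (tri_tu_comm s_tri) // => [t'|t'|i j t'].
- by rewrite s_U1.
- by rewrite s_U2.
- by rewrite s_X1 s_X2 (morphDN (addX1 _)) opprK.
Qed.

Lemma txi_txi i j t : XT i (XT j t) = - XT j (XT i t).
Proof.
rewrite /txi !(addX1, addX2) [X1 i (X1 j t)]X1_X1 [X1 i (X2 _ t)]X1_X2.
by rewrite [X2 _ (X1 j t)]X2_X1 [X2 _ (X2 _ t)]X2_X2 -!opprD addrACA.
Qed.

(** By the graded Leibniz rule one term acquires the factor [x - x'] and the other [x' - x'']; each
    factor turns [h_(k-2)] in three variables into a difference of [h_(k-1)] in two. *)
Lemma tdif_xi_xi k i t (j := (v^-1)%g i) (l := (w^-1)%g j) :
  tdif (hsym (k%:Z - 2) [:: A i; B j; C l] (X1 i (X2 j t))) -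
    hsym (k%:Z - 2) [:: A i; B j; C l] (X1 i (X2 j (tdif t))) =
  hsym (k%:Z - 1) [:: A i; C l] (X2 j t) - hsym (k%:Z - 1) [:: B j; C l] (X2 j t)
  - (hsym (k%:Z - 1) [:: A i; B j] (X1 i t)
     - hsym (k%:Z - 1) [:: A i; C l] (X1 i t)).
Proof.
have AB x : A i (B j x) = B j (A i x) by have [_ ->] := A_tri 'X_i.
have AC x : A i (C l x) = C l (A i x) by rewrite atlrC.
have BC x : B j (C l x) = C l (B j x) by have [_ ->] := C_tri 'X_l.
have HD : {morph hsym (k%:Z - 2) [:: A i; B j; C l] : x y / x + y}.
  by apply: hsym_additive; do !constructor.
rewrite trilinear_hsym; last exact: tdif_tri.
rewrite -(morphDB HD).
(* Inserting [X1] of [d X2] splits the commutator into the relations for [X1] and [X2]; the latter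
   enters with a minus sign since [X1] is odd. *)
have -> : tdif (X1 i (X2 j t)) - X1 i (X2 j (tdif t)) =
    A i (X2 j t) - B j (X2 j t) - (B j (X1 i t) - C l (X1 i t)).
  rewrite -tdif_X1 -[RHS]addrA; congr (_ + _).
  have [_ X1m] := X1_tri i; have [[_ _ X1r] _] := X1_tri i.
  rewrite -(X1m 'X_j) -(X1r 'X_l) -(morphDB (addX1 i)) -tdif_X2 addX1 opprD.
  by rewrite [RHS]addrA subrr add0r.
rewrite (morphDB HD) !(morphDB HD).
have HA := trilinear_hsym (k%:Z - 2) i j l _ (A_tri 'X_i).
have HB := trilinear_hsym (k%:Z - 2) i j l _ (B_tri 'X_j).
have HC := trilinear_hsym (k%:Z - 2) i j l _ (C_tri 'X_l).
rewrite -!HA -!HB -!HC (_ : k%:Z - 2 = k%:Z - 1 - 1); last by rewrite -addrA.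
by rewrite hsym_diff // hsym_diff_tail.
Qed.

(** In degree [k - 1], the terms [h(A, B) X1] and [h(B, C) X2] from the two factors cancel against
    the quadratic term, which leaves [h(A, C) X1 + h(A, C) X2]. *)
Lemma tdif_tu k t : tdif (UT k t) - UT k (tdif t) = \sum_(i < n)
  hsym (k%:Z - 1) [:: A i; C ((w^-1)%g ((v^-1)%g i))] (XT i t).
Proof.
rewrite !tuE !tdifD (morphD_sum tdifD).
rewrite [X in _ + X = _]opprD [LHS]addrACA [X in _ + X + _ = _]opprD
  [X in X + _ = _]addrACA tdif_U1 tdif_U2.
(* The sum from the right factor runs over its own strands [j]; substituting [j = v^-1(i)] aligns it
   with strand [i] of the left factor. *)
rewrite [X in _ + X + _](reindex_inj (@perm_inj _ v^-1%g)) -sumrB -!big_split.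
apply: eq_bigr => i _ /=; rewrite hsym_additive; last by do !constructor.
rewrite tdif_xi_xi; set a := hsym _ _ (X1 i t); set b := hsym _ _ (X2 _ t).
set c := hsym _ _ (X2 _ t); set d := hsym _ _ (X1 i t).
by rewrite opprB [c - b + _]addrC addrACA [a + _]addrC subrK [b + _]addrC subrK.
Qed.

Lemma dg_atensor : dg_module (atensor M N v w) (w * v)%g.
Proof.
have invE i : ((w * v)^-1)%g i = (w^-1)%g ((v^-1)%g i) by rewrite invMg permM.
split=> /=.
- apply: tensor_ext => [x y|x y|m k] //.
    by rewrite !(trilinear_additive s_tri).
  by rewrite /tsgn !tmap_pure // (sgnK dgM) (sgnK dgN).
- by move=> t; rewrite /tdif (trilinear_additive s_tri) s_D1 s_D2 opprD.
- by move=> i t; rewrite /txi (trilinear_additive s_tri) s_X1 s_X2 opprD.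
- exact: tsgn_tu.
- exact: txi_txi.
(* The contributions [A - B] and [B - C] telescope. *)
- move=> i t; rewrite invE /txi tdifD [LHS]addrACA tdif_X1 tdif_X2.
  by rewrite addrA subrK.
- by move=> k t; rewrite tdif_tu; apply: eq_bigr => i _; rewrite invE.
- move=> k i t; rewrite /txi -tu_X1 -tu_X2.
  by rewrite (trilinear_additive (tu_tri k)).
- exact: tu_tu.
Qed.

End Tensor.

(** * The relations for the trivial braid, for one crossing and for a braid word *)

Lemma dg_T1 : dg_module (T1 K n) 1%g.
Proof.
split=> //=; try by move=> *; rewrite oppr0.
- by move=> i x; rewrite addr0 invg1 perm1 subrr.
- move=> k x; rewrite subr0 big1 // => i _.
  by rewrite (morphD0 (hsym_additive _ _)) //; do !constructor; move=> *; rewrite mulrDr.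
Qed.

Section Crossing.
Variables (i : nat) (lti : (i.+1 < n)%N) (eps : bool).
Local Notation R := {mpoly K[n]}.
Local Notation st := (strand lti).
Local Notation stS := (strandS lti).
Local Notation C := (T_ K lti eps).

(** Together with [bstar_b]: for both signs of the crossing, the map opposite to the differential is
    a null-homotopy of [x_i - x'_(i+1)]. *)
Lemma b_bstar (p : R) : b_ (bstar lti p) = 'X_st * p - 'X_stS * p.
Proof.
rewrite /bstar (morphDB (@b_D _ _ _ lti)) !b_E.
by rewrite mulr1 mulrC [p * _]mulrC.
Qed.

Lemma bstar_b (x : Bs K lti) : bstar lti (b_ x) = Bl 'X_st x - Br 'X_stS x.
Proof.
have [bD bl br] := b_bil K lti; have [sD sl sr] := bstar_bil K lti.
move: x; apply: tensor_ext => [x y|x y|p q].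
- by rewrite bD sD.
- by rewrite BlD BrD opprD addrACA.
(* By bilinearity [p] leaves on the left and [q] on the right, which reduces the claim to
   [bstar 1]. *)
- rewrite -[tens _ _ p q]/(Bpure lti p q) b_E BlE BrE mulrC sr -[p in bstar _ p]mulr1 sl.
  rewrite /bstar mul1r (morphDB (@BlD _ _ _ lti p)) (morphDB (@BrD _ _ _ lti q)).
  by rewrite !BlE !BrE !mulr1 mulrC [q * _]mulrC.
Qed.

(** [B_i] is a tensor product over the [s_i]-invariants, so this reaches beyond symmetric
    polynomials to [x_i + x_(i+1)] and to every [x_j] on another strand. *)
Lemma Bl_Br_sym f (x : Bs K lti) : msym (s_ lti) f == f -> Bl f x = Br f x.
Proof.
move=> fE; move: x; apply: tensor_ext => [x y|x y|p q].
- by rewrite BlD.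
- by rewrite BrD.
- by rewrite -[tens _ _ p q]/(Bpure lti p q) BlE BrE mulrC Bpure_inv.
Qed.

Lemma CbK c : Cb (Cb c) = 0 :> C.
Proof. by rewrite /Cb /= (morphD0 (@b_D _ _ _ lti)). Qed.

Lemma CbstarK c : Cbstar (Cbstar c) = 0 :> C.
Proof. by rewrite /Cbstar /= (morphD0 (@bstarD _ _ _ lti)). Qed.

(** The arrow opposite to [Cdif], that is the action of [xi_i]. *)
Definition Cx : C -> C := if eps then @Cbstar _ _ _ lti else @Cb _ _ _ lti.

Lemma Cx_bil : bilinear_end C Cx.
Proof. by rewrite /Cx; case: (eps); [exact: Cbstar_bil | exact: Cb_bil]. Qed.

Lemma CxE j c : Cxi eps j c =
  if j == st then Cx c else if j == stS then - Cx c else 0.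
Proof. by []. Qed.

Lemma Cx_Cx c : Cx (Cx c) = 0.
Proof. by rewrite /Cx; case: (eps); [exact: CbstarK | exact: CbK]. Qed.

Lemma Csgn_Cx c : Csgn (Cx c) = - Cx (Csgn c).
Proof.
rewrite /Cx; case: (eps); congr pair; rewrite /= ?oppr0 //.
by rewrite (morphDN (@bstarD _ _ _ lti)) opprK.
Qed.

Lemma Cdif_Cx c : Cdif eps (Cx c) + Cx (Cdif eps c) = Cl 'X_st c - Cr 'X_stS c.
Proof.
case: c => x p; rewrite /Cx /Cdif; case: (eps); congr pair;
  by rewrite /= ?addr0 ?add0r ?b_bstar ?bstar_b.
Qed.

Lemma Cl_Cr_sym f (c : C) : msym (s_ lti) f == f -> Cl f c = Cr f c.
Proof. by move=> fE; rewrite /Cl /Cr Bl_Br_sym. Qed.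

(* xi_i factors through R, on which x_i, x_(i+1) act on both sides alike. *)
Lemma hsym_Cx m c :
  hsym m [:: @lact _ _ C 'X_st; @ract _ _ C 'X_stS] (Cx c) =
  hsym m [:: @lact _ _ C 'X_stS; @ract _ _ C 'X_st] (Cx c).
Proof.
have mulD (p : R) : {morph (fun q : R => p * q) : x y / x + y}.
  by move=> x y; rewrite mulrDr.
have swap p : hsym m [:: (fun q : R => 'X_st * q); (fun q : R => 'X_stS * q)] p =
    hsym m [:: (fun q : R => 'X_stS * q); (fun q : R => 'X_st * q)] p.
  by apply: hsym_swap => // x; rewrite mulrCA.
have factor (phi : R -> C) p : {morph phi : x y / x + y} ->
    (forall j q, phi ('X_j * q) = Cl 'X_j (phi q)) ->
    (forall j q, phi ('X_j * q) = Cr 'X_j (phi q)) ->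
    hsym m [:: @lact _ _ C 'X_st; @ract _ _ C 'X_stS] (phi p) =
    hsym m [:: @lact _ _ C 'X_stS; @ract _ _ C 'X_st] (phi p).
  move=> phiD phil phir.
  rewrite -(hsym_map m (fs := [:: (fun q : R => 'X_st * q); (fun q : R => 'X_stS * q)]) p phiD).
    rewrite swap; apply: hsym_map => //.
    by do !constructor=> //; move=> x; rewrite (phil, phir).
  by do !constructor=> //; move=> x; rewrite (phil, phir).
case: c => x p; rewrite /Cx; case: (eps).
- have [sD sl sr] := bstar_bil K lti.
  apply: (factor (fun p => (bstar lti p, 0) : C)) => [q r|j q|j q].
  + by congr pair; rewrite /= ?sD ?addr0.
  + by rewrite sl /Cl /= mulr0.
  + by rewrite sr /Cr /= mulr0.
- apply: (factor (fun p => (0, p) : C)) => [q r|j q|j q].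
  + by congr pair; rewrite /= addr0.
  + by rewrite /Cl /= (morphD0 (@BlD _ _ _ lti _)).
  + by rewrite /Cr /= (morphD0 (@BrD _ _ _ lti _)).
Qed.

Lemma dg_T_ : dg_module C (s_ lti).
Proof.
have [xD xl xr] := Cx_bil; have [dD _ _] := Cdif_bil K lti eps.
have SN := strandSN lti.
have hD m j l : {morph hsym m [:: @lact _ _ C 'X_j; @ract _ _ C 'X_l] : x y / x + y}.
  apply: hsym_additive; do !constructor.
    exact: (actD (lactP C)).
  exact: (actD (ractP C)).
split=> /=.
- by case=> x p; rewrite /Csgn /= opprK.
- move=> c; have := Csgn_Cx c.
  rewrite /Cdif; case: c => x p; case: (eps) => _; congr pair; rewrite /= ?oppr0 //.
  by rewrite (morphDN (@bstarD _ _ _ lti)) opprK.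
- move=> j c; rewrite !CxE; case: ifP => _; first exact: Csgn_Cx.
  have [sD _ _] := Csgn_bil K lti.
  case: ifP => _; last by rewrite (morphD0 sD) oppr0.
  by rewrite (morphDN sD) Csgn_Cx.
- move=> k c; congr pair; exact: oppr0.
- move=> j l c; rewrite !CxE; case: (j == st); case: (j == stS); case: (l == st);
    case: (l == stS);
    by rewrite ?(morphDN xD) ?(morphD0 xD) ?Cx_Cx ?oppr0.
- move=> j c; rewrite !CxE tpermV.
  case: eqVneq => [->|jN]; first by rewrite tpermL Cdif_Cx.
  case: eqVneq => [->|jN'].
    (* As [xi_(i+1) = - xi_i], the relation on this strand amounts to [x_i + x_(i+1)] acting alike
       on both sides. *)
    rewrite tpermR (morphDN dD) -opprD Cdif_Cx.
    have := Cl_Cr_sym c (sym_add K lti).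
    rewrite (actDl (@Cl_action _ _ _ lti)) (actDl (@Cr_action _ _ _ lti)) => e; apply/eqP.
    by rewrite opprB subr_eq addrAC eq_sym subr_eq addrC e addrC.
  (* On any other strand [xi_j] is zero and [x_j] is invariant under the transposition. *)
  rewrite (morphD0 dD) addr0 tpermD 1?eq_sym // Cl_Cr_sym ?subrr //.
  by rewrite msym_X tpermD 1?eq_sym.
(* With [u_k = 0] the sum must vanish: two strands contribute, with opposite signs and with the two
   variables exchanged. *)
- move=> k c; rewrite (morphD0 dD) subr0 (bigD1 st) // (bigD1 stS) //=.
  rewrite big1 => [|j /andP[jN jN']]; last first.
    by rewrite CxE (negbTE jN) (negbTE jN') (morphD0 (hD _ _ _)).
  rewrite !CxE eqxx (negbTE SN) eqxx addr0 tpermV tpermL tpermR.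
  by rewrite (morphDN (hD _ _ _)) hsym_Cx subrr.
- move=> k j c; rewrite CxE; case: ifP => _; first by rewrite (morphD0 xD).
  by case: ifP => _ //; rewrite (morphD0 xD) oppr0.
- by [].
Qed.

End Crossing.

Lemma dg_rouquier b : dg_module (rouquier K b) (braid_perm b).
Proof.
elim: b => [|i lti eps|b1 IH1 b2 IH2]; first exact: dg_T1.
- exact: dg_T_.
- exact: dg_atensor.
Qed.

(** * Degrees of the generators of [A_w] on Rouquier complexes *)

Lemma q2_inj : injective (GRing.natmul ((0, 2, 0) : degree)).
Proof.
move=> d d'; rewrite !degree_natmul => -[]; rewrite -!(mulr_natr 2) !natz; lia.
Qed.

(** Closure under negation is included because [sgn] has to preserve degrees. *)
Record graded_module (M : amodule) : Prop := {
  hom0 : forall e, @hom _ _ M e 0;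
  homD : forall e (x y : M), hom e x -> hom e y -> hom e (x + y);
  homN : forall e (x : M), hom e x -> hom e (- x);
  lact_hom : forall i, homog_op (@hom _ _ M) (0, 2, 0) (lact 'X_i);
  ract_hom : forall i, homog_op (@hom _ _ M) (0, 2, 0) (ract 'X_i);
  xi_hom : forall i, homog_op (@hom _ _ M) (0, 2, 1) (xi i);
  u_hom : forall k, homog_op (@hom _ _ M) (0, 2 * k%:Z, 2) (u k)
}.

Lemma sgn_hom0 M : graded_module M -> homog_op (@hom _ _ M) 0 (@sgn _ _ M).
Proof.
move=> gM e x hx; rewrite addr0 (sgn_hom hx) /koszul.
by case: ifP => _ //; apply: (homN gM).
Qed.

Lemma id_hom (V : zmodType) (homV : degree -> V -> Prop) : homog_op homV 0 id.
Proof. by move=> e x; rewrite addr0. Qed.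

Lemma graded_atensor M N v w :
  graded_module M -> graded_module N -> graded_module (atensor M N v w).
Proof.
move=> gM gN.
have tmap_hom (d1 d2 d : degree) (f : M -> M) (g : N -> N) : d = d1 + d2 ->
    bilinear_end M f -> bilinear_end N g ->
    homog_op (@hom _ _ M) d1 f -> homog_op (@hom _ _ N) d2 g ->
    homog_op (@hom _ _ (atensor M N v w)) d (tmap f g).
  move=> -> fB gB; apply: thom_tmap => //.
    by have [] := tmap_bil fB gB.
  by move=> m k; apply: tmap_pure.
have h0 e : hom e (0 : atensor M N v w) by apply: thom0.
have hD e (x y : atensor M N v w) : hom e x -> hom e y -> hom e (x + y).
  exact: thomD.
have idh (V : zmodType) (homV : degree -> V -> Prop) := @id_hom V homV.
have Ah i : homog_op (@hom _ _ (atensor M N v w)) (0, 2, 0) (@atl _ _ M N 'X_i).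
  apply: (tmap_hom (0, 2, 0) 0) => //; last exact: lact_hom.
  exact: bilinear_lact (lactP M) (@lractC _ _ M) _.
have Bh i : homog_op (@hom _ _ (atensor M N v w)) (0, 2, 0) (@atm _ _ M N 'X_i).
  apply: (tmap_hom (0, 2, 0) 0) => //; last exact: ract_hom.
  exact: bilinear_ract (ractP M) (@lractC _ _ M) _.
have Ch i : homog_op (@hom _ _ (atensor M N v w)) (0, 2, 0) (@atr _ _ M N 'X_i).
  apply: (tmap_hom 0 (0, 2, 0)) => //; last exact: ract_hom.
  exact: bilinear_ract (ractP N) (@lractC _ _ N) _.
split=> //.
- by apply: thomN; apply: homN.
- move=> i; apply: homog_add => //.
    by apply: (tmap_hom (0, 2, 1) 0) => //; [exact: xi_bilinear | exact: xi_hom].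
  apply: (tmap_hom 0 (0, 2, 1)) => //.
  + exact: sgn_bilinear.
  + exact: xi_bilinear.
  + exact: sgn_hom0.
  + exact: xi_hom.
- move=> k; apply: homog_add => //; first apply: homog_add => //.
  + by apply: (tmap_hom (0, 2 * k%:Z, 2) 0); rewrite ?addr0 //;
      [exact: u_bilinear | exact: u_hom].
  + by apply: (tmap_hom 0 (0, 2 * k%:Z, 2)); rewrite ?add0r //;
      [exact: u_bilinear | exact: u_hom].
  apply: homog_sum => // i.
  (* In the quadratic term, [h_(k-2)] has quantum degree [2(k - 2)] and [xi (x) xi] has degree
     [(0, 4, 2)]. *)
  apply: (homog_comp (d1 := (0, 2 * (k%:Z - 2), 0)) (d2 := (0, 4, 2))).
  + by congr (_, _, _); rewrite //=; lia.
  + by apply: homog_hsym => //; do !constructor.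
  + apply: (tmap_hom (0, 2, 1) (0, 2, 1)) => //.
    * exact: bilinear_comp (xi_bilinear _ _) (sgn_bilinear _).
    * exact: xi_bilinear.
    * apply: (homog_comp (d1 := (0, 2, 1)) (d2 := 0)) => //.
        exact: xi_hom.
      exact: sgn_hom0.
    * exact: xi_hom.
Qed.

Lemma graded_T1 : graded_module (T1 K n).
Proof.
have hX i : homog_op (@hom _ _ (T1 K n)) (0, 2, 0) (fun p => 'X_i * p).
  by move=> e p hp; rewrite addrC; apply: poly_homM => //; apply: poly_homX.
split=> //=; try by move=> *; left.
- by move=> e p q; apply: (poly_homD q2_inj).
- exact: poly_homN.
Qed.

Lemma graded_T_ i (lti : (i.+1 < n)%N) eps : graded_module (T_ K lti eps).
Proof.
have RX j (e : degree) p : R_hom e p -> @R_hom K n (e + (0, 2, 0)) ('X_j * p).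
  by move=> hp; rewrite addrC; apply: poly_homM => //; apply: poly_homX.
have R0 e : @R_hom K n e 0 by left.
have RD e p q : R_hom e p -> R_hom e q -> @R_hom K n e (p + q).
  exact: (poly_homD q2_inj).
have RN e p : R_hom e p -> @R_hom K n e (- p) by apply: poly_homN.
have B0 e : @Bhom K n i lti e 0 by apply: thom0.
have BN e (x : Bs K lti) : Bhom e x -> Bhom e (- x) by apply: thomN.
have Rl j : homog_op (@R_hom K n) (0, 2, 0) (fun p => 'X_j * p).
  by move=> e p; apply: RX.
have Blh j : homog_op (@Bhom K n i lti) (0, 2, 0) (Bl 'X_j).
  apply: (thom_tmap (d1 := (0, 2, 0)) (d2 := 0)) => //; last exact: id_hom.
    exact: BlD.
  by move=> p q; rewrite -[tens _ _ p q]/(Bpure lti p q) [LHS]BlE.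
have Brh j : homog_op (@Bhom K n i lti) (0, 2, 0) (Br 'X_j).
  apply: (thom_tmap (d1 := 0) (d2 := (0, 2, 0))) => //; last exact: id_hom.
    exact: BrD.
  by move=> p q; rewrite -[tens _ _ p q]/(Bpure lti p q) [LHS]BrE.
have bh e x : Bhom e x -> R_hom e (@b_ K n i lti x).
  move=> hx; rewrite -[e]addr0; move: x hx; apply: thom_morph => //.
    exact: b_D.
  move=> e1 e2 p q hp hq; rewrite addr0 -[tens _ _ p q]/(Bpure lti p q) b_E.
  exact: poly_homM.
have bsh e p : R_hom e p -> Bhom (e + (0, 2, 0)) (@bstar K n i lti p).
  move=> hp; apply: thomD; last apply: BN.
    apply: (thom_tens _ _ (e1 := e + (0, 2, 0)) (e2 := 0)); last by rewrite addr0.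
      by rewrite mulrC; apply: RX.
    exact: poly_hom1.
  by apply: (thom_tens _ _ (e1 := e) (e2 := (0, 2, 0))) => //; apply: poly_homX.
have C0 e : @Chom K n i lti eps e 0 by split.
have CN e (c : Bs K lti * {mpoly K[n]}) : Chom eps e c -> Chom eps e (- c).
  by case=> h1 h2; split; [exact: BN | exact: RN].
split=> //=.
- move=> e x y [hx1 hx2] [hy1 hy2]; split; first exact: thomD.
  exact: RD.
- move=> j e x [h1 h2]; split=> /=; first by rewrite addrAC; apply: Blh.
  by case: (eps) h2 => h2; rewrite addrAC; apply: RX.
- move=> j e x [h1 h2]; split=> /=; first by rewrite addrAC; apply: Brh.
  by case: (eps) h2 => h2; rewrite addrAC; apply: RX.
- move=> j e c hc.
  have hx : Chom eps (e + (0, 2, 1)) (@Cx i lti eps c).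
    (* The quantum degree 2 of [xi_i] comes from [bstar] for a positive crossing, and from the
       shifts of [B_i(1)] and [R(-1)] for a negative one. *)
    case: (eps) hc => -[h1 h2]; split=> //=.
    + have -> : e + (0, 2, 1) + (0, 1, 0) = e + (0, 1, 1) + (0, 2, 0).
        by rewrite -!addrA.
      exact: bsh.
    + have -> : e + (0, 2, 1) - (0, 1, 1) = e + (0, 1, 0) by rewrite -addrA.
      exact: bh.
  rewrite CxE; case: ifP => _ //; case: ifP => _ //.
  exact: CN.
Qed.

Lemma graded_rouquier b : graded_module (rouquier K b).
Proof.
elim: b => [|i lti eps|b1 IH1 b2 IH2]; first exact: graded_T1.
- exact: graded_T_.
- exact: graded_atensor.
Qed.

(** * The y-ified complex *)

Section Yified.
Variable b : braid n.
Local Notation M := (rouquier K b).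
Local Notation w := (braid_perm b).
Local Notation Y := (Y K b).
Local Notation P := {mpoly K[n]}.
Local Notation pure v p :=
  (tens (fun (c : K) (m : M) => lact c%:MP m) (fun (c : K) (q : P) => c *: q) v p).
Let dgM := dg_rouquier b.
Let gM := graded_rouquier b.

Definition linear_end (g : P -> P) : Prop :=
  {morph g : p q / p + q} /\ forall c p, g (c *: p) = c *: g p.

Section TensorMaps.
Variables (f : M -> M) (g : P -> P).
Hypotheses (fB : bilinear_end M f) (gL : linear_end g).

Lemma onTE v p : onT f (pure v p) = pure (f v) p.
Proof. by have [fD fl _] := fB; apply: tmapE. Qed.

Lemma onTD : {morph (@onT K n b f) : x y / x + y}.
Proof. by have [fD fl _] := fB; apply: tmapD. Qed.

Lemma onyE v p : ony g (pure v p) = pure v (g p).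
Proof. by have [gD gZ] := gL; apply: tmapE. Qed.

Lemma onyD : {morph (@ony K n b g) : x y / x + y}.
Proof. by have [gD gZ] := gL; apply: tmapD. Qed.

Lemma onT_ony z : onT f (ony g z) = ony g (onT f z) :> Y.
Proof.
move: z; apply: tensor_ext => [x y|x y|v p].
- by rewrite onyD onTD.
- by rewrite onTD onyD.
- by rewrite onyE !onTE onyE.
Qed.

End TensorMaps.

Lemma onT_onT f g z : bilinear_end M f -> bilinear_end M g ->
  (forall v, f (g v) = g (f v)) -> onT f (onT g z) = onT g (onT f z) :> Y.
Proof.
move=> fB gB fgC; have fD := onTD fB; have gD := onTD gB.
move: z; apply: tensor_ext => [x y|x y|v p].
- by rewrite gD fD.
- by rewrite fD gD.
- by rewrite !onTE // fgC.
Qed.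

Lemma y_linear i : linear_end (fun p => 'X_i * p).
Proof. by split=> [p q|c p]; rewrite ?mulrDr ?scalerAr. Qed.

Lemma mderiv_linear i : linear_end (mderiv i).
Proof. by split=> [p q|c p]; rewrite ?mderivD ?mderivZ. Qed.

Lemma lactX_bil p : bilinear_end M (lact p).
Proof. exact: bilinear_lact (lactP M) (@lractC _ _ M) p. Qed.

Lemma ractX_bil p : bilinear_end M (ract p).
Proof. exact: bilinear_ract (ractP M) (@lractC _ _ M) p. Qed.

#[local] Hint Resolve y_linear mderiv_linear lactX_bil ractX_bil dif_bilinear
  xi_bilinear u_bilinear : core.

Lemma xD i : {morph (@x_ K n b i) : x y / x + y}. Proof. exact: onTD. Qed.
Lemma x'D i : {morph (@x'_ K n b i) : x y / x + y}. Proof. exact: onTD. Qed.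
Lemma xiD i : {morph (@xi_ K n b i) : x y / x + y}. Proof. exact: onTD. Qed.
Lemma uD k : {morph (@u_ K n b k) : x y / x + y}. Proof. exact: onTD. Qed.
Lemma yD i : {morph (@y_ K n b i) : x y / x + y}. Proof. exact: onyD. Qed.
Lemma ddyD i : {morph (@ddy K n b i) : x y / x + y}. Proof. exact: onyD. Qed.

Lemma hD m i : {morph (@h_xx' K n b m i) : x y / x + y}.
Proof. by apply: hsym_additive; do !constructor; [exact: xD | exact: x'D]. Qed.

Lemma FD k : {morph (@F K n b k) : x y / x + y}.
Proof.
move=> x y; rewrite /F uD addrACA -big_split; congr (_ + _).
by apply: eq_bigr => i _; rewrite ddyD hD.
Qed.

Lemma d_yD : {morph (@d_y K n b) : x y / x + y}.
Proof.
move=> x y; rewrite /d_y onTD // addrACA -big_split; congr (_ + _).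
by apply: eq_bigr => i _; rewrite yD xiD.
Qed.

Lemma ddy_y i j (z : Y) : ddy j (y_ i z) = y_ i (ddy j z) + (if i == j then z else 0).
Proof.
move: z; apply: tensor_ext => [x y|x y|v p].
- by rewrite yD ddyD.
- by rewrite ddyD yD addrACA; case: eqP => _; rewrite ?addr0.
- rewrite /ddy /y_ !onyE // mderivM mderivX mnm1E.
  have [->|_] := eqVneq i j; last by rewrite scale0r mul0r add0r addr0.
  by rewrite -{1}[U_(j)%MM]add0m addmK mpolyX0 scale1r mul1r tensDr addrC.
Qed.

(** Such operators commute with the coefficients [h_(k-1)] of [F_k]. Multiplication by [y_i], [d_y]
    and the [F_m] themselves all qualify. *)
Definition central (phi : Y -> Y) : Prop := [/\ {morph phi : x y / x + y},
  forall i z, phi (x_ i z) = x_ i (phi z) &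
  forall i z, phi (x'_ i z) = x'_ i (phi z)].

Lemma central_onT f : bilinear_end M f -> central (onT f).
Proof.
move=> fB; split; first exact: onTD.
  by move=> i z; apply: onT_onT => //; have [_ fl _] := fB.
by move=> i z; apply: onT_onT => //; have [_ _ fr] := fB.
Qed.

Lemma central_ony g : linear_end g -> central (ony g).
Proof. by move=> gL; split; [exact: onyD | |] => i z; rewrite -onT_ony. Qed.

Lemma central_h phi m i z : central phi -> phi (h_xx' m i z) = h_xx' m i (phi z).
Proof. by case=> phiD phix phix'; apply: hsym_map => //; do !constructor. Qed.

(** Centrality moves [phi] inside the coefficients, so only its commutators with the derivatives and
    with [u_k] remain to be computed. *)
Lemma F_commutator phi k z : central phi ->
  phi (F k z) - F k (phi z) =
  \sum_(j < n) h_xx' (k%:Z - 1) j (phi (ddy j z) - ddy j (phi z)) +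
  (phi (u_ k z) - u_ k (phi z)).
Proof.
move=> phiC; have [phiD _ _] := phiC; rewrite /F phiD opprD addrACA; congr (_ + _).
rewrite (morphD_sum phiD) -sumrB; apply: eq_bigr => i _.
by rewrite (morphDB (@hD _ _)) central_h.
Qed.

Lemma F_comm phi k z : central phi ->
  (forall j x, phi (ddy j x) = ddy j (phi x)) ->
  (forall x, phi (u_ k x) = u_ k (phi x)) -> phi (F k z) = F k (phi z).
Proof.
move=> phiC phid phiu; apply/eqP; rewrite -subr_eq0 F_commutator // phiu subrr addr0.
by rewrite big1 // => j _; rewrite phid subrr (morphD0 (@hD _ _)).
Qed.

Lemma onT_F f k z : bilinear_end M f -> (forall v, f (u k v) = u k (f v)) ->
  onT f (F k z) = F k (onT f z) :> Y.
Proof.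
move=> fB fu; apply: F_comm; first exact: central_onT.
  by move=> j x; apply: onT_ony.
by move=> x; apply: onT_onT.
Qed.

Lemma x_F i k z : x_ i (F k z) = F k (x_ i z) :> Y.
Proof. by apply: onT_F => // v; have [_ ->] := u_bilinear M k. Qed.

Lemma x'_F i k z : x'_ i (F k z) = F k (x'_ i z) :> Y.
Proof. by apply: onT_F => // v; have [_ _ ->] := u_bilinear M k. Qed.

Lemma F_central k : central (F k).
Proof. by split=> [|i z|i z]; [exact: FD | rewrite x_F | rewrite x'_F]. Qed.

(** The coefficients of [F_k] do not involve the variables [y], and partial derivatives commute. *)
Lemma ddy_F i k z : ddy i (F k z) = F k (ddy i z) :> Y.
Proof.
apply: F_comm => [|j x|x]; first exact: central_ony.
  move: x; apply: tensor_ext => [x y|x y|v p].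
  - by rewrite !ddyD.
  - by rewrite !ddyD.
  - by rewrite /ddy !onyE // mderiv_comm.
by rewrite /u_ onT_ony.
Qed.

Lemma F_F k m z : F k (F m z) = F m (F k z) :> Y.
Proof.
apply: F_comm => [|j x|x]; first exact: F_central.
  by rewrite ddy_F.
by rewrite -onT_F // => v; rewrite (u_u dgM).
Qed.

Lemma F_y i k z : F k (y_ i z) - y_ i (F k z) = h_xx' (k%:Z - 1) i z :> Y.
Proof.
rewrite -opprB F_commutator; last exact: central_ony.
(* [u_k] and all derivatives other than that in [y_i] commute with [y_i], which leaves one
   summand. *)
rewrite /u_ onT_ony // subrr addr0 (bigD1 i) //= big1 => [|j jN].
  by rewrite addr0 -(morphDN (@hD _ _)) opprB ddy_y eqxx addrAC subrr add0r.
by rewrite ddy_y eq_sym (negbTE jN) addr0 subrr (morphD0 (@hD _ _)).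
Qed.

Lemma ddy_onT f i z : bilinear_end M f ->
  ddy i (onT f z) = onT f (ddy i z) :> Y.
Proof. by move=> fB; rewrite /ddy onT_ony. Qed.

Lemma dif_u_Y k z : onT (@dif _ _ M) (u_ k z) - u_ k (onT (@dif _ _ M) z) =
  \sum_(i < n) h_xx' (k%:Z - 1) i (xi_ i z) :> Y.
Proof.
have dD := onTD (dif_bilinear M).
move: z; apply: tensor_ext => [x y|x y|v p].
- by rewrite uD !dD uD opprD addrACA.
- by rewrite -big_split; apply: eq_bigr => i _; rewrite xiD hD.
- rewrite /u_ !onTE // -tensNl -tensDl (dif_u dgM).
  have tl v1 v2 : pure (v1 + v2) p = pure v1 p + pure v2 p by apply: tensDl.
  rewrite (morphD_sum (f := fun v => pure v p) tl); apply: eq_bigr => i _.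
  rewrite /xi_ onTE //; apply: (hsym_map (phi := fun v => pure v p)) => //.
  by do !constructor; move=> x; rewrite /x_ /x'_ onTE.
Qed.

Lemma d_y_F k z : d_y (F k z) = F k (d_y z) :> Y.
Proof.
have d_yC : central (@d_y K n b).
  split=> [|i x|i x]; first exact: d_yD.
    rewrite /d_y xD (morphD_sum (xD i)) /x_ [in RHS]onT_onT //; last first.
      by have [_ dl _] := dif_bilinear M.
    congr (_ + _); apply: eq_bigr => j _; rewrite /y_ -onT_ony //.
    by apply: onT_onT => // v; have [_ ->] := xi_bilinear M j.
  rewrite /d_y x'D (morphD_sum (x'D i)) /x'_ [in RHS]onT_onT //; last first.
    by have [_ _ dr] := dif_bilinear M.
  congr (_ + _); apply: eq_bigr => j _; rewrite /y_ -onT_ony //.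
  by apply: onT_onT => // v; have [_ _ ->] := xi_bilinear M j.
apply/eqP; rewrite -subr_eq0 F_commutator //.
(* The curved terms [xi_i y_i] commute with [u_k], so only the internal differential contributes. *)
have -> : d_y (u_ k z) - u_ k (d_y z) = \sum_(i < n) h_xx' (k%:Z - 1) i (xi_ i z).
  rewrite /d_y uD (morphD_sum (uD k)) opprD addrACA dif_u_Y -sumrB.
  rewrite [X in _ + X]big1 ?addr0 // => i _; rewrite /y_ -onT_ony // /xi_ /u_.
  rewrite [onT _ (onT _ _)]onT_onT ?subrr // => v.
  by rewrite (u_xi dgM).
(* The cancellation takes place for each [j] separately, inside the common coefficient [h_(k-1)]. *)
rewrite -big_split big1 //= => j _; rewrite -hD.
rewrite -[RHS](morphD0 (@hD (k%:Z - 1) j)); congr h_xx'.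
rewrite /d_y ddyD (morphD_sum (ddyD j)) opprD addrACA ddy_onT // subrr add0r.
rewrite -sumrB (bigD1 j) //= big1 => [|i iN]; rewrite ddy_onT // ddy_y.
  by rewrite eqxx -[onT _ _]/(xi_ j _) xiD addr0 opprD addrA subrr add0r addNr.
by rewrite (negbTE iN) addr0 subrr.
Qed.

Lemma F_linear k : linear (@F K n b k).
Proof.
move=> c x y; rewrite FD; congr (_ + _); apply/esym.
(* Scalars act on [Y] as left multiplication by constant polynomials, with which [u_k] commutes. *)
by apply: (onT_F (f := lact c%:MP)) => // v; have [_ ->] := u_bilinear M k.
Qed.

Lemma F_homog k : homog_op (@Y_hom K n b) (0, 2 * k%:Z, 2) (F k).
Proof.
have Y0 e : @Y_hom K n b e 0 by apply: thom0.
have YD e (x y : Y) : Y_hom e x -> Y_hom e y -> Y_hom e (x + y) by apply: thomD.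
have onT_hom d f : bilinear_end M f -> homog_op (@hom _ _ M) d f ->
    homog_op (@Y_hom K n b) d (onT f).
  move=> fB fh; apply: (thom_tmap (d1 := d) (d2 := 0)) => //.
  - by rewrite addr0.
  - exact: onTD.
  - exact: onTE.
  - exact: id_hom.
apply: homog_add => //; last by apply: onT_hom => //; apply: u_hom.
apply: homog_sum => // i.
(* [h_(k-1)] contributes quantum degree [2(k - 1)], and a derivative [(0, 2, 2)], the negative of
   the degree of [y_i]. *)
apply: (homog_comp (d1 := (0, 2 * (k%:Z - 1), 0)) (d2 := (0, 2, 2))).
- by congr (_, _, _); rewrite //=; lia.
- apply: homog_hsym => //; do !constructor; apply: onT_hom => //.
    exact: lact_hom.
  exact: ract_hom.
- apply: (thom_tmap (d1 := 0) (d2 := (0, 2, 2))) => //.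
  + exact: ddyD.
  + by move=> v p; apply: onyE.
  + exact: id_hom.
  + exact: poly_hom_mderiv.
Qed.

End Yified.
End DgModules.

Theorem theorem1p9 (R : realType) (n : nat) (b : braid n) (k : nat) :
  (1 <= k <= n)%N ->
  [/\ linear (@F R[i] n b k),
      homog_op (@Y_hom R[i] n b) (0, 2 * k%:Z, 2) (F k),
      forall z, scomm (-1) 2 (@d_y R[i] n b) (F k) z = 0,
      forall m, (1 <= m <= n)%N ->
        forall z, scomm 2 2 (@F R[i] n b k) (F m) z = 0
    & forall i,
        (forall z, scomm 2 0 (@F R[i] n b k) (x_ i) z = 0) /\
        (forall z, scomm 2 (-2) (@F R[i] n b k) (y_ i) z = h_xx' (k%:Z - 1) i z)].
Proof.
move=> _; split.
- exact: F_linear.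
- exact: F_homog.
(* [F_k] has even homological degree, so every supercommutator here is an ordinary commutator. *)
- by move=> z; rewrite /scomm d_y_F /koszul /= subrr.
- by move=> m _ z; rewrite /scomm F_F /koszul /= subrr.
- move=> i; split=> z; first by rewrite /scomm x_F /koszul /= subrr.
  by rewrite /scomm /koszul /= F_y.
Qed.
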